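(* Let $a,b,c,d,\tau,\eta\in\mathbb{R}$ with $ad-bc=1$ and $b\neq0$, let $p\ge2$ be a real number, and let $t_m,\xi_m\in\mathbb{R}$ be arbitrary fixed constants. Let $f:\mathbb{R}\to\mathbb{C}$ and suppose that $f(t)$, $O_f^J(\xi)$ and $|\xi-\xi_m|^pO_f^J(\xi)$ belong to $L^1(\mathbb{R})\cap L^2(\mathbb{R})$, where $O_f^J$ is the offset linear canonical transform of $f$. Then $$\left(\int_{\mathbb{R}}|t-t_m|^p|f(t)|^2\,\mathrm{d}t\right)^{\frac1p}\left(\int_{\mathbb{R}}|\xi-\xi_m|^p|O_f^J(\xi)|^2\,\mathrm{d}\xi\right)^{\frac1p}\ \ge\ \frac{|b|}{2}\,\sqrt[p]{E_{|f|^2}^2},\qquad E_{|f|^2}=\int_{\mathbb{R}}|f(t)|^2\,\mathrm{d}t.$$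
   Context: $\mathrm{j}$ denotes the imaginary unit. For $J=\left[\begin{array}{cc|c}a&b&\tau\\c&d&\eta\end{array}\right]$ with real entries, $ad-bc=1$, $b\ne0$, the offset linear canonical transform (OLCT) of $f$ is $$O_f^J(\xi)=\int_{-\infty}^{+\infty}f(t)\frac{1}{\sqrt{\mathrm{j}2\pi b}}\,\mathrm{e}^{\mathrm{j}\left[\frac{a}{2b}t^2-\frac1b t(\xi-\tau)-\frac1b\xi(d\tau-b\eta)+\frac{d}{2b}(\xi^2+\tau^2)\right]}\mathrm{d}t.$$ The moment integral of $f$ may be $+\infty$ (with the usual conventions for extended nonnegative reals). *)

(* Defs.v *)
From HB Require Import structures.
From mathcomp Require Import all_boot all_order all_algebra.
From mathcomp Require Import all_classical all_reals all_analysis.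
From mathcomp Require Import complex.

Set Implicit Arguments.
Unset Strict Implicit.
Unset Printing Implicit Defensive.

Import Order.TTheory GRing.Theory Num.Theory.
Import numFieldNormedType.Exports.

Local Open Scope classical_set_scope.
Local Open Scope ring_scope.

Definition cabs (R : realType) (z : R[i]) : R := ComplexField.Normc.normc z.

Definition expj (R : realType) (theta : R) : R[i] :=
  Complex (cos theta) (sin theta).

Definition cintegral (R : realType) (g : R -> R[i]) : R[i] :=
  Complex (\int[lebesgue_measure]_t complex.Re (g t))
          (\int[lebesgue_measure]_t complex.Im (g t)).

(* The sigma-algebra carried by [R] is the Borel one, whereas elements of
   L^q(R) are only Lebesgue measurable, i.e. a.e. equal to a Borel function.
   Integrals against [lebesgue_measure] are suprema over Borel simple
   functions, so they give the usual value on Lebesgue measurable functions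
   as well. *)
Definition in_Lspace (R : realType) (q : \bar R) (g : R -> R[i]) : Prop :=
  exists h : R -> R[i],
    [/\ measurable_fun [set: R] (fun x => complex.Re (h x)),
        measurable_fun [set: R] (fun x => complex.Im (h x)),
        finite_norm lebesgue_measure q (fun x => cabs (h x)) &
        {ae lebesgue_measure, forall x : R, g x = h x}].

Definition in_L1_cap_L2 (R : realType) (g : R -> R[i]) : Prop :=
  in_Lspace 1%:E g /\ in_Lspace 2%:E g.

Definition olct_phase (R : realType) (a b d tau eta xi t : R) : R :=
  a / (2 * b) * t ^+ 2 - b^-1 * t * (xi - tau)
  - b^-1 * xi * (d * tau - b * eta) + d / (2 * b) * (xi ^+ 2 + tau ^+ 2).

(* Parameters in the order of J = [a b | tau; c d | eta]; the entry c does not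
   occur in the kernel. [sqrtc] is the principal branch of the square root. *)
Definition OLCT (R : realType) (a b c d tau eta : R) (f : R -> R[i]) (xi : R)
    : R[i] :=
  cintegral (fun t =>
    f t * (sqrtc (Complex 0 (2 * pi * b)))^-1
    * expj (olct_phase a b d tau eta xi t)).

Definition energy (R : realType) (g : R -> R[i]) : \bar R :=
  (\int[lebesgue_measure]_x (cabs (g x) ^+ 2)%:E)%E.

Definition moment (R : realType) (p x0 : R) (g : R -> R[i]) : \bar R :=
  (\int[lebesgue_measure]_x (`|x - x0| `^ p * cabs (g x) ^+ 2)%:E)%E.

(* Main.v *)
Require Import Defs.
From HB Require Import structures.
From mathcomp Require Import all_boot all_order all_algebra.
From mathcomp Require Import all_classical all_reals all_analysis.
From mathcomp Require Import measurable_realfun.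
From mathcomp Require Import complex ring lra.

(* Write [O(xi) = C(xi) G(xi / b)], where [C] has constant modulus and [G] is the
   Fourier transform of a chirp multiple [g] of [f], so that [|g| = |f|].
   Since [O] is integrable, the Fourier inversion formula and Plancherel's
   identity hold; inversion is obtained by damping with [e^(- eps |w|)], whose
   transform is the Poisson kernel, and testing against intervals.

   For the case [p = 2], put [k_h(t) = g(t + h) - e^(i theta) g(t)] with
   [theta = xi_m h / b].  Translation invariance gives, without boundary terms,
   [\int (t - t_m) (|g(t)|^2 - |g(t + h)|^2) dt = h \int |g|^2], while the
   integrand on the left is at most
   [|t - t_m| |k_h(t)| (|g(t)| + |g(t + h)|)], and Plancherel bounds the norm of
   [k_h] by [|h / b|] times the second moment of [O].  The weighted AM-GM
   inequality and [h -> 0] give the uncertainty inequality.  Jensen's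
   inequality for [x^(p / 2)] then passes to general [p]. *)

Set Implicit Arguments.
Unset Strict Implicit.
Unset Printing Implicit Defensive.

Import Order.TTheory GRing.Theory Num.Theory.
Import numFieldNormedType.Exports.

Local Open Scope classical_set_scope.
Local Open Scope ring_scope.

(** * Integrable real functions *)

Section real_integrals.
Context {R : realType}.
Notation mu := (@lebesgue_measure R).
Notation integ f := (mu.-integrable [set: R] (EFin \o f)).
Implicit Types f g p q : R -> R.

(** [f] is not assumed continuous or differentiable, so the usual argument through a derivative and
    an integration by parts is out of reach: the increment [k_h] takes the place of the derivative,
    and each moment is compared with its own translate. Integrals are those of real functions, so a
    complex function [g] is carried as a pair [u], [v], and complex identities are used through
    their real parts; an imaginary part is the real part for [- i g], that is for the pair [v],
    [- u].

    Constants, with [beta = 1 / b]: Plancherel's identity carries the factor [2 * pi / |beta|], and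
    the constant in front of the kernel has squared modulus [|beta| / (2 * pi)]. Hence [|O|^2] has
    the same mass [E] as [|f|^2], and Jensen's inequality is applied to both densities with the same
    [E].

    In the extended reals [0 * +oo] is [0], so an infinite moment does not settle the inequality
    alone: the other moment must be positive. This holds unless [E = 0], and then the right-hand
    side vanishes. *)

Lemma integ_measurable f : integ f -> measurable_fun setT f.
Proof. by move=> /integrableP[/measurable_EFinP]. Qed.

Lemma integ_le f g : measurable_fun setT f -> integ g ->
  (forall x, `|f x| <= g x) -> integ f.
Proof.
move=> mf ig fg; apply: (le_integrable _ _ _ ig) => //.
  exact/measurable_EFinP.
by move=> x _; rewrite /= lee_fin (le_trans (fg x))// ler_norm.
Qed.

Lemma integD f g : integ f -> integ g -> integ (fun x => f x + g x).
Proof. by move=> /integrableD h /h; apply. Qed.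

Lemma integB f g : integ f -> integ g -> integ (fun x => f x - g x).
Proof. by move=> /integrableB h /h; apply. Qed.

Lemma integN f : integ f -> integ (fun x => - f x).
Proof. by move=> /integrableN h; apply: h. Qed.

Lemma integZ k f : integ f -> integ (fun x => k * f x).
Proof. by move=> /(integrableZl measurableT k) h; apply: h. Qed.

Lemma integ_norm f : integ f -> integ (fun x => `|f x|).
Proof. exact: integrable_norm. Qed.

Lemma integ_bounded M f g : integ f -> measurable_fun setT g ->
  (forall x, `|g x| <= M) -> integ (fun x => f x * g x).
Proof.
move=> fi mg gM; apply: (integ_le _ (integZ M (integ_norm fi))).
  by apply: measurable_funM => //; exact: integ_measurable.
by move=> x; rewrite normrM mulrC ler_wpM2r.
Qed.

Lemma norm_Rint f g : integ f -> integ g -> (forall x, `|f x| <= g x) ->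
  `|\int[mu]_x f x| <= \int[mu]_x g x.
Proof.
move=> fi gi fg; rewrite (le_trans (le_normr_Rintegral measurableT fi))//.
by apply: le_Rintegral => //; exact: integ_norm.
Qed.

Lemma integ_eq f g : f =1 g -> integ f -> integ g.
Proof. by move=> /funext ->. Qed.

Lemma EFin_Rint f : integ f -> (\int[mu]_x f x)%:E = (\int[mu]_x (f x)%:E)%E.
Proof. by move=> fi; rewrite /Rintegral fineK//; exact: integrable_fin_num. Qed.

(** Lebesgue measure is determined by its values on half-open intervals, so [phi] pushes [mu]
    forward to [mu]; what remains is the change of variables for a pushforward. *)
Lemma integ_measure_preserving (phi : measurableTypeR R -> measurableTypeR R) f :
  measurable_fun setT phi ->
  (forall a b, mu (phi @^-1` `]a, b]) = mu `]a, b]) ->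
  integ f -> integ (f \o phi) /\ \int[mu]_x f (phi x) = \int[mu]_x f x.
Proof.
move=> mphi phiab fi.
have mue A : measurable A -> mu A = pushforward mu phi A.
  by apply: lebesgue_measure_unique => //= _ [[a b] /= ab <-]; rewrite -phiab.
have mf := integ_measurable fi.
have ie (g : R -> \bar R) : measurable_fun setT g -> (forall x, 0 <= g x)%E ->
    (\int[mu]_x g (phi x) = \int[mu]_x g x)%E.
  move=> mg g0; rewrite -[LHS](@ge0_integral_pushforward _ _ _ _ _ _ mphi mu setT)//.
  by apply: eq_measure_integral => //= A mA _; exact/esym/mue.
have fpi : integ (f \o phi).
  apply/integrableP; split; first by apply/measurable_EFinP; exact: measurableT_comp.
  rewrite (ie (fun x => `|(f x)%:E|)%E)//; first by case/integrableP : fi.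
  by apply: measurableT_comp => //; exact/measurable_EFinP.
split=> //; congr fine.
rewrite -[LHS](@integral_pushforward _ _ _ _ _ _ mphi mu setT (EFin \o f))//.
  by apply: eq_measure_integral => //= A mA _; exact/esym/mue.
exact/measurable_EFinP.
Qed.

Lemma integ_translate h f : integ f -> integ (fun x => f (x + h)) /\
  \int[mu]_x f (x + h) = \int[mu]_x f x.
Proof.
apply: (@integ_measure_preserving (fun x => x + h)).
  exact: measurable_funD.
move=> a b.
rewrite (_ : _ @^-1` _ = `]a - h, b - h]%classic); last first.
  by apply/seteqP; split=> x /=; rewrite !in_itv/= ltrBlDr lerBrDr.
rewrite !lebesgue_measure_itv/= !lte_fin ltrD2r; case: ifP => // _.
by rewrite -!EFinB; congr EFin; ring.
Qed.

Lemma integ_opp f : integ f -> integ (fun x => f (- x)) /\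
  \int[mu]_x f (- x) = \int[mu]_x f x.
Proof.
apply: (@integ_measure_preserving -%R) => [|a b]; first exact: oppr_measurable.
rewrite (_ : _ @^-1` _ = `[- b, - a[%classic); last first.
  by apply/seteqP; split=> x /=; rewrite !in_itv/= ltrNr lerNl andbC.
rewrite !lebesgue_measure_itv/= !lte_fin ltrN2; case: ifP => // _.
by rewrite -!EFinB; congr EFin; ring.
Qed.

Lemma dominated_integrable_prod (F : R * R -> R) p q : measurable_fun setT F ->
  integ p -> integ q -> (forall x y, `|F (x, y)| <= p x * q y) ->
  (mu \x mu)%E.-integrable setT (EFin \o F).
Proof.
move=> mF ip iq Fpq.
apply/integrable12ltyP; first exact/measurable_EFinP.
apply: (@le_lt_trans _ _ (\int[mu]_x (`|p x| * \int[mu]_y `|q y|)%:E)%E); last first.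
  apply: integrable_lty => //.
  by have := integZ (\int[mu]_y `|q y|) (integ_norm ip);
    under eq_fun do rewrite mulrC.
apply: ge0_le_integral => //=.
- by move=> x _; exact: integral_ge0.
- apply: (@measurable_fun_fubini_tonelli_F _ _ _ _ _ mu
    (fun z : measurableTypeR R * measurableTypeR R => `|(F z)%:E|)%E) => //=.
  apply: measurableT_comp => //.
  have nF : measurable_fun setT (fun z => `|F z|) by exact: measurableT_comp.
  exact nF.
- apply/measurable_EFinP; apply: measurable_funM => //.
  by apply: measurableT_comp => //; exact: integ_measurable.
move=> x _; rewrite EFinM EFin_Rint; last exact: integ_norm.
rewrite -ge0_integralZl//=; last first.
  by apply/measurable_EFinP; apply: measurableT_comp => //; exact: integ_measurable.
apply: ge0_le_integral => //=.
- apply/measurable_EFinP; do 2 apply: measurableT_comp => //.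
- apply/measurable_EFinP; apply: measurable_funM => //.
  by apply: measurableT_comp => //; exact: integ_measurable.
- by move=> y _; rewrite -EFinM lee_fin -normrM (le_trans (Fpq _ _))// ler_norm.
Qed.

(** Domination by a product, at every point, makes every slice integrable and not only almost every
    one; the inner integrals are then genuine real numbers throughout. *)
Lemma dominated_Fubini (F : R * R -> R) p q : measurable_fun setT F ->
  integ p -> integ q -> (forall x y, `|F (x, y)| <= p x * q y) ->
  [/\ forall x, integ (fun y => F (x, y)),
      forall y, integ (fun x => F (x, y)),
      integ (fun x => \int[mu]_y F (x, y)),
      integ (fun y => \int[mu]_x F (x, y)) &
      \int[mu]_x \int[mu]_y F (x, y) = \int[mu]_y \int[mu]_x F (x, y)].
Proof.
move=> mF ip iq Fpq.
have iF := dominated_integrable_prod mF ip iq Fpq.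
have mFs : measurable_fun setT (F \o (fun z => (z.2, z.1))).
  by apply: measurableT_comp => //; exact: measurable_fun_pair.
have Fqp y x : `|(F \o (fun z => (z.2, z.1))) (y, x)| <= q y * p x
  by rewrite mulrC; exact: Fpq.
have iFs := dominated_integrable_prod mFs iq ip Fqp.
have iF1 x : integ (fun y => F (x, y)).
  apply: (integ_le _ (integZ (p x) iq)) => //.
  by apply: measurableT_comp => //; exact: measurable_pair1.
have iF2 y : integ (fun x => F (x, y)).
  apply: (integ_le _ (integZ (q y) ip)) => [|x].
    by apply: measurableT_comp => //; exact: measurable_pair2.
  by rewrite mulrC; exact: Fpq.
have e1 : EFin \o (fun x => \int[mu]_y F (x, y)) =
    (fun x => \int[mu]_y (F (x, y))%:E)%E.
  by apply/funext => x /=; rewrite EFin_Rint.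
have e2 : EFin \o (fun y => \int[mu]_x F (x, y)) =
    (fun y => \int[mu]_x (F (x, y))%:E)%E.
  by apply/funext => x /=; rewrite EFin_Rint.
split => //.
- by rewrite e1; exact: (integrable_fubini_F iF).
- by rewrite e2; exact: (integrable_fubini_F iFs).
have := Fubini iF.
  rewrite -[X in integral _ _ X = _]e1 -[X in _ = integral _ _ X]e2.
  by rewrite /Rintegral => ->.
Qed.
End real_integrals.

(** * The Poisson kernel *)

Section poisson_kernel.
Context {R : realType}.
Notation mu := (@lebesgue_measure R).
Notation integ f := (mu.-integrable [set: R] (EFin \o f)).
Variables (eps : R) (eps0 : 0 < eps).

Let abel (w : R) := expR (- eps * `|w|).

Let cexp : continuous (fun w : R => expR (- eps * w)).
Proof.
move=> w; apply: (@continuous_comp _ _ _ (fun w => - eps * w) expR).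
  exact: mulrl_continuous.
exact: continuous_expR.
Qed.

Let ccos c : continuous (fun w : R => cos (c * w)).
Proof.
move=> w; apply: (@continuous_comp _ _ _ (fun w => c * w) cos).
  exact: mulrl_continuous.
exact: continuous_cos.
Qed.

Let csin c : continuous (fun w : R => sin (c * w)).
Proof.
move=> w; apply: (@continuous_comp _ _ _ (fun w => c * w) sin).
  exact: mulrl_continuous.
exact: continuous_sin.
Qed.

Let cabel : continuous abel.
Proof.
move=> w.
apply: (@continuous_comp _ _ _ (fun w : R => `|w|) (fun w => expR (- eps * w))).
  exact: norm_continuous.
exact: cexp.
Qed.

Lemma denom_gt0 (c : R) : 0 < eps ^+ 2 + c ^+ 2.
Proof. by rewrite ltr_wpDr ?sqr_ge0// exprn_gt0. Qed.

(** An antiderivative that vanishes at [+oo]. The summand [1] in [1 + cos (c * w)] keeps the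
    integrand nonnegative, as the improper form of the fundamental theorem used below demands; the
    cosine transform is recovered by subtracting half of the case [c = 0]. *)
Let F c (w : R) := expR (- eps * w) *
  (c / (eps ^+ 2 + c ^+ 2) * sin (c * w) -
   eps / (eps ^+ 2 + c ^+ 2) * cos (c * w) - eps^-1).

Let dF c w : is_derive w (1 : R) (F c) (expR (- eps * w) * (1 + cos (c * w))).
Proof.
have d k : is_derive w (1 : R) (fun w => k * w) k.
  by apply: is_derive_eq; rewrite /GRing.scale/= mulr1.
have de : is_derive w (1 : R) (fun w => expR (- eps * w)) (expR (- eps * w) * - eps).
  exact: (@is_derive1_comp _ expR (fun w => - eps * w)).
have dc : is_derive w (1 : R) (fun w => cos (c * w)) (- sin (c * w) * c).
  exact: (@is_derive1_comp _ cos (fun w => c * w)).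
have ds : is_derive w (1 : R) (fun w => sin (c * w)) (cos (c * w) * c).
  exact: (@is_derive1_comp _ sin (fun w => c * w)).
apply: is_derive_eq.
have := denom_gt0 c => /gt_eqF/negbT h.
have := eps0 => /gt_eqF/negbT h'.
rewrite /GRing.scale/=; field.
by rewrite h h'.
Qed.

Let F_cvg c : F c w @[w --> +oo%R] --> (0 : R).
Proof.
have e0 : expR (- eps * w) @[w --> +oo%R] --> (0 : R).
  rewrite (_ : (fun x => expR (- eps * x)) =
               (fun z => expR (- z)) \o (fun z => eps * z)); last first.
    by apply: eq_fun => x; rewrite mulNr.
  apply: (@cvg_comp _ _ _ _ _ _ (pinfty_nbhs R)); last exact: cvgr_expR.
  exact: gt0_cvgMry.
pose K := `|c / (eps ^+ 2 + c ^+ 2)| + `|eps / (eps ^+ 2 + c ^+ 2)| + `|eps^-1|.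
have FK w : `|F c w| <= expR (- eps * w) * K.
  rewrite normrM ger0_norm ?expR_ge0// ler_wpM2l ?expR_ge0//.
  rewrite (le_trans (ler_normB _ _))// lerD// (le_trans (ler_normB _ _))//.
  by rewrite !normrM lerD// ler_piMr// ?sin_max ?cos_max.
have eK : expR (- eps * w) * K @[w --> +oo%R] --> (0 : R).
  by rewrite -(mul0r K); apply: cvgMl.
apply: (@squeeze_cvgr _ _ _ _ (fun w => - (expR (- eps * w) * K))
  (fun w => expR (- eps * w) * K)) => //.
- by apply: nearW => w; rewrite -ler_norml.
- by rewrite -oppr0; apply: cvgN.
Qed.

Let integral_1cos c : (\int[mu]_w (abel w * (1 + cos (c * w)))%:E =
  (2 * (eps^-1 + eps / (eps ^+ 2 + c ^+ 2)))%:E)%E.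
Proof.
have c1 : continuous (fun w => 1 + cos (c * w)).
  by move=> w; apply: cvgD; [exact: cvg_cst|exact: ccos].
have p1 w : 0 <= 1 + cos (c * w) by rewrite -lerBlDl sub0r cos_geN1.
rewrite ge0_symfun_integralT; first last.
- by move=> w; rewrite /abel/= normrN mulrN cosN.
- by move=> w; apply: cvgM; [exact: cabel|exact: c1].
- by move=> w; rewrite mulr_ge0// expR_ge0.
rewrite -set_itvcy.
under eq_integral => w.
  rewrite inE/= in_itv/= andbT => w0.
  rewrite /abel ger0_norm//; over.
rewrite (@ge0_continuous_FTC2y _ _ (F c) _ 0).
- rewrite -EFinB -EFinM; congr (2 * _)%:E.
  by rewrite /F !mulr0 expR0 sin0 cos0 mulr0 !mulr1 mul1r; ring.
- by move=> w _; rewrite mulr_ge0// expR_ge0.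
- apply: continuous_subspaceT => w.
  by apply: cvgM; [exact: cexp|exact: c1].
- exact: F_cvg.
- by move=> w _; apply: ex_derive; exact: dF.
- apply: cvg_at_right_filter; apply: differentiable_continuous.
  by apply/derivable1_diffP; apply: ex_derive; exact: dF.
- by move=> w _; rewrite derive1E; apply: derive_val; exact: dF.
Qed.

Let integ_1cos c : integ (fun w => abel w * (1 + cos (c * w))).
Proof.
have p1 w : 0 <= abel w * (1 + cos (c * w)).
  by rewrite mulr_ge0 ?expR_ge0// -lerBlDl sub0r cos_geN1.
apply/integrableP; split.
  apply/measurable_EFinP; apply: continuous_measurable_fun => w.
  apply: cvgM; first exact: cabel.
  by apply: cvgD; [exact: cvg_cst|exact: ccos].
under eq_integral do rewrite /= ger0_norm//.
by rewrite integral_1cos ltry.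
Qed.

Lemma integ_abel : integ (fun w => expR (- eps * `|w|)).
Proof.
have := integZ 2^-1 (integ_1cos 0).
by apply: integ_eq => w /=; rewrite mul0r cos0 mulrC -mulrA divff ?mulr1.
Qed.

Lemma Rint_abel_cos c :
  \int[mu]_w (expR (- eps * `|w|) * cos (c * w)) = 2 * eps / (eps ^+ 2 + c ^+ 2).
Proof.
have r1 c' : \int[mu]_w (abel w * (1 + cos (c' * w))) =
    2 * (eps^-1 + eps / (eps ^+ 2 + c' ^+ 2)).
  by rewrite /Rintegral integral_1cos.
have ra : \int[mu]_w (expR (- eps * `|w|)) = 2 * eps^-1.
  transitivity (2^-1 * \int[mu]_w (abel w * (1 + cos (0 * w)))).
    rewrite -RintegralZl//; apply: eq_Rintegral => w _.
    by rewrite mul0r cos0 /abel; field.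
  rewrite r1; field; exact: lt0r_neq0.
transitivity (\int[mu]_w (abel w * (1 + cos (c * w)) - abel w)).
  by apply: eq_Rintegral => w _; rewrite /abel; ring.
rewrite RintegralB//; last exact: integ_abel.
by rewrite r1 ra mulrDr addrC addKr mulrA.
Qed.

Lemma Rint_abel_sin c : \int[mu]_w (expR (- eps * `|w|) * sin (c * w)) = 0.
Proof.
have is1 : integ (fun w => abel w * sin (c * w)).
  apply: (@integ_bounded _ 1); first exact: integ_abel.
    by apply: continuous_measurable_fun; exact: csin.
  by move=> w; exact: sin_max.
have [_] := integ_opp is1.
under eq_Rintegral do rewrite /abel normrN mulrN sinN mulrN -mulN1r.
by rewrite RintegralZl//; rewrite /abel; lra.
Qed.

End poisson_kernel.

(** * Fourier transforms in real form *)

Section trig_transform.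
Context {R : realType}.
Notation mu := (@lebesgue_measure R).
Notation integ f := (mu.-integrable [set: R] (EFin \o f)).
Variable beta : R.
Implicit Types u v p q : R -> R.

(* With [g = u + i v], the real and imaginary parts of
   [w |-> \int g(t) e^(- i beta w t) dt] are [trig_transform u v] and
   [trig_transform v (- u)]. *)
Definition trig_transform u v (w : R) : R :=
  \int[mu]_t (u t * cos (beta * w * t) + v t * sin (beta * w * t)).

Lemma measurable_cosM (c : R) : measurable_fun setT (fun t : R => cos (c * t)).
Proof.
apply: continuous_measurable_fun => t.
apply: (@continuous_comp _ _ _ ( *%R c) cos); first exact: mulrl_continuous.
exact: continuous_cos.
Qed.

Lemma measurable_sinM (c : R) : measurable_fun setT (fun t : R => sin (c * t)).
Proof.
apply: continuous_measurable_fun => t.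
apply: (@continuous_comp _ _ _ ( *%R c) sin); first exact: mulrl_continuous.
exact: continuous_sin.
Qed.

Lemma integ_cosM u c : integ u -> integ (fun t => u t * cos (c * t)).
Proof.
move=> iu; apply: (@integ_bounded _ 1) => //; first exact: measurable_cosM.
by move=> t; exact: cos_max.
Qed.

Lemma integ_sinM u c : integ u -> integ (fun t => u t * sin (c * t)).
Proof.
move=> iu; apply: (@integ_bounded _ 1) => //; first exact: measurable_sinM.
by move=> t; exact: sin_max.
Qed.

Lemma integ_trig u v w : integ u -> integ v ->
  integ (fun t => u t * cos (beta * w * t) + v t * sin (beta * w * t)).
Proof. by move=> iu iv; apply: integD; [exact: integ_cosM|exact: integ_sinM]. Qed.

Lemma norm_trig (a b x : R) : `|a * cos x + b * sin x| <= `|a| + `|b|.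
Proof.
rewrite (le_trans (ler_normD _ _))// lerD// normrM ler_piMr//.
  exact: cos_max.
exact: sin_max.
Qed.

Lemma norm_trig_transform u v w : integ u -> integ v ->
  `|trig_transform u v w| <= \int[mu]_t (`|u t| + `|v t|).
Proof.
move=> iu iv; apply: norm_Rint; first exact: integ_trig.
  by apply: integD; exact: integ_norm.
by move=> t; exact: norm_trig.
Qed.

Let measurable_phase : measurable_fun setT (fun z : R * R => beta * z.1 * z.2).
Proof. by apply: measurable_funM => //; exact: measurable_funM. Qed.

Let measurable_cosp : measurable_fun setT (fun z : R * R => cos (beta * z.1 * z.2)).
Proof.
apply: measurableT_comp; last exact: measurable_phase.
by apply: continuous_measurable_fun; exact: continuous_cos.
Qed.

Let measurable_sinp : measurable_fun setT (fun z : R * R => sin (beta * z.1 * z.2)).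
Proof.
apply: measurableT_comp; last exact: measurable_phase.
by apply: continuous_measurable_fun; exact: continuous_sin.
Qed.

Let measurable_trigp u v : measurable_fun setT u -> measurable_fun setT v ->
  measurable_fun setT (fun z : R * R =>
    u z.2 * cos (beta * z.1 * z.2) + v z.2 * sin (beta * z.1 * z.2)).
Proof.
move=> mu' mv; apply: measurable_funD; apply: measurable_funM => //.
  exact: (measurableT_comp mu').
exact: (measurableT_comp mv).
Qed.

(** With [g = u + i v] and [P = p - i q], this is the real part of the exchange formula for Fourier
    transforms, [\int P G = \int g Q], where [G] and [Q] are the transforms of [g] and [P]. It
    serves with [P] a damped wave for inversion, and with [P] the conjugate of [G] for Plancherel's
    identity. *)
Lemma trig_swap p q u v : integ p -> integ q -> integ u -> integ v ->
  \int[mu]_w (p w * trig_transform u v w + q w * trig_transform v (\- u) w) =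
  \int[mu]_t (u t * trig_transform p (\- q) t + v t * trig_transform q p t).
Proof.
move=> ip iq iu iv.
have iNu := integN iu; have iNq := integN iq.
have mp := integ_measurable ip; have mq := integ_measurable iq.
have mu' := integ_measurable iu; have mv := integ_measurable iv.
have mNu := integ_measurable iNu.
pose F z := p z.1 * (u z.2 * cos (beta * z.1 * z.2) + v z.2 * sin (beta * z.1 * z.2))
  + q z.1 * (v z.2 * cos (beta * z.1 * z.2) + (- u z.2) * sin (beta * z.1 * z.2)).
have mF : measurable_fun setT F.
  apply: measurable_funD; apply: measurable_funM.
  - exact: (measurableT_comp mp).
  - exact: measurable_trigp.
  - exact: (measurableT_comp mq).
  - exact: (@measurable_trigp v (\- u)).
have Fb w t : `|F (w, t)| <= (`|p w| + `|q w|) * (`|u t| + `|v t|).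
  apply: (le_trans (ler_normD _ _)); rewrite mulrDl; apply: lerD;
    rewrite normrM; apply: ler_wpM2l => //.
    exact: norm_trig.
  by apply: (le_trans (norm_trig _ _ _)); rewrite normrN addrC.
have [_ _ _ _] := dominated_Fubini mF (integD (integ_norm ip) (integ_norm iq))
  (integD (integ_norm iu) (integ_norm iv)) Fb.
rewrite (_ : (fun x => \int[mu]_y F (x, y)) =
  (fun w => p w * trig_transform u v w + q w * trig_transform v (\- u) w)); last first.
  apply/funext => w; rewrite -!RintegralZl//; try exact: integ_trig.
  by rewrite -RintegralD//; apply: integZ; exact: integ_trig.
rewrite (_ : (fun y => \int[mu]_x F (x, y)) =
  (fun t => u t * trig_transform p (\- q) t + v t * trig_transform q p t)) //.
apply/funext => t; rewrite -!RintegralZl//; try exact: integ_trig.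
rewrite -RintegralD//; try by apply: integZ; exact: integ_trig.
apply: eq_Rintegral => w _; rewrite /F/= (_ : beta * t * w = beta * w * t); ring.
Qed.

(** Fubini's theorem yields measurability in [w] only for an integrand that is integrable in both
    variables; the weight [e^(- |w|)] is inserted for this purpose and divided out afterwards. *)
Lemma measurable_trig_transform u v : integ u -> integ v ->
  measurable_fun setT (trig_transform u v).
Proof.
move=> iu iv.
have ip := @integ_abel R 1 ltr01.
have mu' := integ_measurable iu; have mv := integ_measurable iv.
have mp := integ_measurable ip.
pose p (w : R) := expR (- 1 * `|w|).
pose F z := p z.1 * (u z.2 * cos (beta * z.1 * z.2) + v z.2 * sin (beta * z.1 * z.2)).
have mF : measurable_fun setT F.
  apply: measurable_funM; last exact: measurable_trigp.
  exact: (measurableT_comp mp).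
have Fb w t : `|F (w, t)| <= p w * (`|u t| + `|v t|).
  by rewrite normrM ger0_norm ?expR_ge0// ler_wpM2l ?expR_ge0//=; exact: norm_trig.
have [_ _ iT _ _] := dominated_Fubini mF ip
  (integD (integ_norm iu) (integ_norm iv)) Fb.
rewrite (_ : trig_transform u v =
    (fun w => expR `|w| * \int[mu]_t F (w, t))); last first.
  apply/funext => w.
  have -> : \int[mu]_t F (w, t) = p w * trig_transform u v w.
    by rewrite -RintegralZl//; exact: integ_trig.
  by rewrite mulrA -expRD mulN1r subrr expR0 mul1r.
apply: measurable_funM; last exact: integ_measurable iT.
exact: measurableT_comp.
Qed.

Lemma eq_trig_transform u v u' v' w : u =1 u' -> v =1 v' ->
  trig_transform u v w = trig_transform u' v' w.
Proof. by move=> /funext -> /funext ->. Qed.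

Lemma trig_transform_translate h u v w : integ u -> integ v ->
  trig_transform (fun t => u (t + h)) (fun t => v (t + h)) w =
  cos (beta * w * h) * trig_transform u v w -
  sin (beta * w * h) * trig_transform v (\- u) w.
Proof.
move=> iu iv; have iNu := integN iu.
rewrite -!RintegralZl//; try exact: integ_trig.
rewrite -RintegralB//; try by apply: integZ; exact: integ_trig.
transitivity (\int[mu]_t (u t * cos (beta * w * (t - h)) +
    v t * sin (beta * w * (t - h)))).
  have io : integ (fun t => u t * cos (beta * w * (t - h)) +
      v t * sin (beta * w * (t - h))).
    have [+ _] := integ_translate (- h)
      (integ_trig w (integ_translate h iu).1 (integ_translate h iv).1).
    by apply: integ_eq => t /=; rewrite subrK.
  have [_ <-] := integ_translate h io.
  by apply: eq_Rintegral => t _; rewrite addrK.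
apply: eq_Rintegral => t _ /=.
rewrite (_ : beta * w * (t - h) = beta * w * t - beta * w * h); last by ring.
by rewrite cosB sinB; ring.
Qed.

End trig_transform.

(** * Dominated convergence, functions determined by their integrals over intervals, arctangent
    limits *)

Section limits.
Context {R : realType}.
Notation mu := (@lebesgue_measure R).
Notation integ f := (mu.-integrable [set: R] (EFin \o f)).

Lemma Rint_dominated_cvg (f_ : nat -> R -> R) (f g : R -> R) :
  (forall n, measurable_fun setT (f_ n)) ->
  (forall x, f_ n x @[n --> \oo] --> f x) ->
  integ g -> (forall n x, `|f_ n x| <= g x) ->
  \int[mu]_x f_ n x @[n --> \oo] --> \int[mu]_x f x.
Proof.
move=> mf_ f_f ig f_g.
have mf : measurable_fun setT f by exact: (measurable_fun_cvg mf_).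
have h1 n : measurable_fun [set: measurableTypeR R] (EFin \o f_ n).
  by apply/measurable_EFinP; exact: mf_.
have h2 : measurable_fun [set: measurableTypeR R] (EFin \o f).
  by apply/measurable_EFinP; exact: mf.
have h3 : {ae mu, forall x, setT x -> (EFin \o f_ n) x @[n --> \oo] --> (EFin \o f) x}.
  by apply: aeW => x _; apply: cvg_EFin; [exact: nearW|exact: f_f].
have h4 : {ae mu, forall x n, setT x -> (`|(EFin \o f_ n) x| <= (EFin \o g) x)%E}.
  by apply: aeW => x n _; rewrite lee_fin.
have [fi _ h] := dominated_convergence measurableT h1 h2 h3 ig h4.
apply: fine_cvg; rewrite fineK; first exact: h.
exact: integrable_fin_num.
Qed.

Lemma indic_ge0 (A : set R) (x : R) : 0 <= \1_A x :> R.
Proof. by rewrite indicE ler0n. Qed.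

Lemma indic_norm_le1 (A : set R) (x : R) : `|\1_A x : R| <= 1.
Proof. by rewrite ger0_norm ?indic_ge0// indicE; case: (_ \in _). Qed.

Lemma Rint_indic (A : set R) (f : R -> R) : measurable A ->
  \int[mu]_(x in A) f x = \int[mu]_x (f x * \1_A x).
Proof.
move=> mA; rewrite Rintegral_mkcond; apply: eq_Rintegral => x _.
by rewrite patchE indicE; case: ifP => _; rewrite ?mulr1 ?mulr0.
Qed.

Lemma integ_ae_eq (f g : R -> R) : measurable_fun setT g -> integ f ->
  {ae mu, forall x, f x = g x} -> integ g /\ \int[mu]_x f x = \int[mu]_x g x.
Proof.
move=> mg fi fg; have mf := integ_measurable fi.
have mEf : measurable_fun [set: measurableTypeR R] (EFin \o f).
  by apply/measurable_EFinP; exact: mf.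
have mEg : measurable_fun [set: measurableTypeR R] (EFin \o g).
  by apply/measurable_EFinP; exact: mg.
split; last first.
  rewrite /Rintegral; congr fine.
  apply: (@ae_eq_integral _ _ _ mu setT (EFin \o g) (EFin \o f)) => //.
  by apply: (@filterS _ _ (ae_filter_ringOfSetsType mu)) fg => x /= ->.
apply/integrableP; split => //.
have /integrableP[_] := fi; apply: le_lt_trans.
rewrite le_eqVlt; apply/orP; left; apply/eqP.
apply: ge0_ae_eq_integral => //.
- exact: measurableT_comp.
- exact: measurableT_comp.
by apply: (@filterS _ _ (ae_filter_ringOfSetsType mu)) fg => x /= ->.
Qed.

(** The cut-off of [f] to [[- n, n]] is integrable with a vanishing primitive, and almost everywhere
    the derivative of that primitive is the cut-off itself. A countable union of null sets then
    covers all [n]. *)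
Lemma ae_eq0_of_itv (f : R -> R) :
  (forall a b, integ (fun x => f x * \1_(`[a, b]%classic) x)) ->
  (forall a b, \int[mu]_(x in `[a, b]) f x = 0) ->
  {ae mu, forall x, f x = 0}.
Proof.
move=> fi f0.
pose g (n : nat) (x : R) := f x * \1_(`[- n%:R, n%:R]%classic) x.
have ae_g n : {ae mu, forall x, g n x = 0}.
  have gi : integ (g n) by exact: fi.
  have gy y : mu.-integrable `]-oo, y] (EFin \o g n).
    by apply: integrableS gi.
  have := FTC1Ny gy (open_integrable_locally openT gi).
  rewrite (_ : (fun x => _) = cst 0).
    apply: (@filterS _ _ (ae_filter_ringOfSetsType mu)) => x [_ <-].
    by rewrite derive1E; exact: derive_cst.
  (* [[- n, n]] meets []-oo, y]] in [[- n, min n y]], which is empty for [y < - n]; [f0] covers that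
     case because it holds for endpoints in any order. *)
  apply/funext => y; rewrite Rint_indic// -[RHS](f0 (- n%:R) (Num.min n%:R y)).
  rewrite [RHS]Rint_indic//; apply: eq_Rintegral => x _.
  rewrite /g -mulrA; congr (_ * _).
  transitivity (\1_(`[- n%:R, n%:R] `&` `]-oo, y]) x : R); first by rewrite indicI.
  congr (\1_ _ x).
  apply/seteqP; split => z /=; rewrite !in_itv/= le_min.
    by move=> [/andP[-> ->] ->].
  by move=> /andP[-> /andP[-> ->]].
have := @ae_foralln _ _ _ mu (fun n x => g n x = 0) ae_g.
apply: (@filterS _ _ (ae_filter_ringOfSetsType mu)) => x gx.
pose n := Num.Def.archi_bound `|x|.
have := gx n; rewrite /g indicE mem_set ?mulr1//= in_itv/=.
have xn : `|x| <= n%:R by rewrite ltW// archi_boundP.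
by rewrite -ler_norml.
Qed.

Lemma cvg_atan_mulrn (a : R) :
  atan (a * n.+1%:R) @[n --> \oo] --> Num.sg a * (pi / 2).
Proof.
have pos (b : R) : 0 < b -> atan (b * n.+1%:R) @[n --> \oo] --> pi / 2.
  move=> b0.
  have h0 : (n.+1%:R : R) @[n --> \oo] --> (pinfty_nbhs R).
    by rewrite (cvg_shiftS (fun n => n%:R : R)); exact: cvgr_idn.
  have h : b * n.+1%:R @[n --> \oo] --> (pinfty_nbhs R).
    exact: (cvg_comp _ _ h0 (gt0_cvgMry b0 cvg_id)).
  exact: (cvg_comp _ _ h (@cvgy_atan R)).
have [a0|a0|->] := ltgtP a 0.
- rewrite ltr0_sg// mulN1r.
  have := pos (- a); rewrite oppr_gt0 => /(_ a0) h.
  rewrite (_ : (fun n => _) = (fun n => - atan (- a * n.+1%:R))); last first.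
    by apply/funext => n; rewrite mulNr atanN opprK.
  exact: cvgN.
- by rewrite gtr0_sg// mul1r; exact: pos.
- rewrite sgr0 mul0r; under eq_fun do rewrite mul0r atan0.
  exact: cvg_cst.
Qed.

Lemma norm_atan (x : R) : `|atan x| <= pi / 2.
Proof. by rewrite ler_norml !ltW ?atan_gtNpi2 ?atan_ltpi2. Qed.

Lemma continuous_poisson (beta eps t : R) : 0 < eps ->
  continuous (fun x => 2 * eps / (eps ^+ 2 + (beta * (x - t)) ^+ 2)).
Proof.
move=> eps0 x; apply: cvgM; first exact: cvg_cst.
apply: cvgV; first by rewrite lt0r_neq0// denom_gt0.
apply: cvgD; first exact: cvg_cst.
have h : {for x, continuous (fun x => beta * (x - t))}.
  apply: cvgM; first exact: cvg_cst.
  by apply: cvgB; [exact: cvg_id|exact: cvg_cst].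
by rewrite expr2; under eq_fun do rewrite expr2; apply: cvgM.
Qed.

Lemma Rint_poisson_itv (beta eps a b t : R) : beta != 0 -> 0 < eps -> a < b ->
  \int[mu]_(x in `[a, b]) (2 * eps / (eps ^+ 2 + (beta * (x - t)) ^+ 2)) =
  2 / beta * (atan (beta * (b - t) / eps) - atan (beta * (a - t) / eps)).
Proof.
move=> beta0 eps0 ab.
pose F x := 2 / beta * atan (beta / eps * (x - t)).
have dF (x : R) : is_derive x (1 : R) F (2 * eps / (eps ^+ 2 + (beta * (x - t)) ^+ 2)).
  have d1 : is_derive x (1 : R) (fun x => beta / eps * (x - t)) (beta / eps).
    by apply: is_derive_eq; rewrite /GRing.scale/= subr0 mulr1.
  have d2 := @is_derive1_comp _ atan (fun x => beta / eps * (x - t)) _ _ _ _ d1.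
  have d3 : is_derive x (1 : R) (fun x => atan (beta / eps * (x - t)))
     ((1 + (beta / eps * (x - t)) ^+ 2)^-1 * (beta / eps)).
    exact: d2.
  apply: is_derive_eq; rewrite /GRing.scale/=.
  have e0 : eps != 0 by exact: lt0r_neq0.
  have h1 : eps ^+ 2 + (beta * (x - t)) ^+ 2 != 0.
    by rewrite lt0r_neq0// denom_gt0.
  field.
  by rewrite beta0 e0 h1.
have cF : continuous F.
  move=> x; apply: differentiable_continuous.
  by apply/derivable1_diffP; apply: ex_derive; exact: dF.
rewrite /Rintegral (@continuous_FTC2 _ _ F)//.
- by rewrite /= /F -mulrBr; congr (_ * (atan _ - atan _)); ring.
- by apply: continuous_subspaceT; exact: continuous_poisson.
- split.
  + by move=> x _; apply: ex_derive; exact: dF.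
  + by apply: cvg_at_right_filter; exact: cF.
  + by apply: cvg_at_left_filter; exact: cF.
- by move=> x _; rewrite derive1E; apply: derive_val; exact: dF.
Qed.

End limits.

(** * Inversion and Plancherel *)

Section inversion.
Context {R : realType}.
Notation mu := (@lebesgue_measure R).
Notation integ f := (mu.-integrable [set: R] (EFin \o f)).
Variables (beta : R) (u v : R -> R).
Hypotheses (beta0 : beta != 0) (iu : integ u) (iv : integ v).
Let U := trig_transform beta u v.
Let V := trig_transform beta v (\- u).
Hypotheses (iU : integ U) (iV : integ V).
Let iNV : integ (\- V). Proof. exact: integN. Qed.

(** The exchange formula for the damped wave [e^(- eps |w|) e^(i beta x w)]. Its transform at [t] is
    the Poisson kernel at [x - t], which is real, so that [v] drops out. *)
Lemma poisson_trig eps x : 0 < eps ->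
  \int[mu]_t (u t * (2 * eps / (eps ^+ 2 + (beta * (x - t)) ^+ 2))) =
  \int[mu]_w (expR (- eps * `|w|) *
    (U w * cos (beta * x * w) + (\- V) w * sin (beta * x * w))).
Proof.
move=> eps0; have ia := integ_abel eps0.
pose p w := expR (- eps * `|w|) * cos (beta * x * w).
pose q w := - (expR (- eps * `|w|) * sin (beta * x * w)).
have ip : integ p by exact: integ_cosM.
have iq : integ q by apply: integN; exact: integ_sinM.
have Tp t : trig_transform beta p (\- q) t =
    2 * eps / (eps ^+ 2 + (beta * (x - t)) ^+ 2).
  rewrite -Rint_abel_cos//; apply: eq_Rintegral => w _.
  rewrite (_ : beta * (x - t) * w = beta * x * w - beta * t * w); last by ring.
  by rewrite cosB /p /q/=; ring.
have Tq t : trig_transform beta q p t = 0.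
  rewrite -(mulr0 (-1)) -(Rint_abel_sin eps0 (beta * (x - t))).
  rewrite -RintegralZl//; last first.
    exact: integ_sinM.
  apply: eq_Rintegral => w _.
  rewrite (_ : beta * (x - t) * w = beta * x * w - beta * t * w); last by ring.
  by rewrite sinB /p /q/=; ring.
transitivity (\int[mu]_t (u t * trig_transform beta p (\- q) t +
    v t * trig_transform beta q p t)).
  by apply: eq_Rintegral => t _; rewrite Tp Tq mulr0 addr0.
rewrite -trig_swap//; apply: eq_Rintegral => w _.
by rewrite -/U -/V /p /q /=; ring.
Qed.

Let M := \int[mu]_w (`|U w| + `|V w|).

Let iUV : integ (fun w => `|U w| + `|V w|).
Proof. by apply: integD; exact: integ_norm. Qed.

Let abel_bound (eps a w : R) : 0 < eps ->
  `|expR (- eps * `|w|) * (U w * cos a + (\- V) w * sin a)| <= `|U w| + `|V w|.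
Proof.
move=> eps0; rewrite normrM ger0_norm ?expR_ge0//.
rewrite -[leRHS]mul1r ler_pM ?expR_ge0//.
  by rewrite -expR0 ler_expR mulNr oppr_le0 mulr_ge0// ltW.
by rewrite (le_trans (norm_trig _ _ _))// normrN.
Qed.

Let measurable_abel_integrand (eps x : R) : 0 < eps ->
  measurable_fun setT (fun w : R => expR (- eps * `|w|) *
    (U w * cos (beta * x * w) + (\- V) w * sin (beta * x * w))).
Proof.
move=> eps0; apply: measurable_funM.
  exact: integ_measurable (integ_abel eps0).
by apply: integ_measurable; exact: integ_trig.
Qed.

Let phi (eps x : R) :=
  \int[mu]_t (u t * (2 * eps / (eps ^+ 2 + (beta * (x - t)) ^+ 2))).

(** The Poisson kernel is of size [2 / eps]; a bound uniform in [eps] and [x] is visible only on the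
    frequency side. *)
Let phi_bound eps x : 0 < eps -> `|phi eps x| <= M.
Proof.
move=> eps0; rewrite /phi poisson_trig//; apply: norm_Rint => //.
  apply: (integ_le _ iUV) => [|w]; last exact: abel_bound.
  exact: measurable_abel_integrand.
by move=> w; exact: abel_bound.
Qed.

Let eps_ (n : nat) : R := n.+1%:R^-1.

Let eps_gt0 n : 0 < eps_ n. Proof. by rewrite invr_gt0. Qed.

(** On the frequency side the damping factor tends to [1], under the dominating function
    [|U| + |V|]. *)
Let phi_cvg x : phi (eps_ n) x @[n --> \oo] --> trig_transform beta U (\- V) x.
Proof.
rewrite (_ : (fun n => _) = (fun n => \int[mu]_w (expR (- eps_ n * `|w|) *
    (U w * cos (beta * x * w) + (\- V) w * sin (beta * x * w))))); last first.
  by apply/funext => n; rewrite /phi poisson_trig.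
apply: (Rint_dominated_cvg _ _ iUV).
- by move=> n; exact: measurable_abel_integrand.
- move=> w; rewrite -[X in _ --> X]mul1r.
  apply: cvgM; last exact: cvg_cst.
  rewrite -expR0; apply: continuous_cvg; first exact: continuous_expR.
  rewrite -(mul0r `|w|) -oppr0; apply: cvgM; last exact: cvg_cst.
  by apply: cvgN; exact: cvg_harmonic.
- by move=> n w; exact: abel_bound.
Qed.

Let poisson_kernel_bound (eps y : R) : 0 < eps ->
  `|2 * eps / (eps ^+ 2 + (beta * y) ^+ 2)| <= 2 / eps.
Proof.
move=> eps0; rewrite ger0_norm; last first.
  by rewrite divr_ge0// ?mulr_ge0// ?ltW// denom_gt0.
rewrite ler_pdivrMr ?denom_gt0// mulrAC ler_pdivlMr// -mulrA ler_pM2l//.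
by rewrite -expr2 lerDl sqr_ge0.
Qed.

Let measurable_poisson (eps : R) : 0 < eps -> measurable_fun setT
  (fun z : R * R => 2 * eps / (eps ^+ 2 + (beta * (z.1 - z.2)) ^+ 2)).
Proof.
move=> eps0.
have m1 := continuous_measurable_fun (@continuous_poisson _ beta eps 0 eps0).
have m2 : measurable_fun setT (fun z : R * R => z.1 - z.2) by exact: measurable_funB.
have := measurableT_comp m1 m2.
by under eq_fun do rewrite /= subr0.
Qed.

Let indic_itv_integ (a b : R) : integ (\1_(`[a, b]%classic)).
Proof. exact: integrable_indic_itv. Qed.

(** Integrating first in [x] turns the kernel into a difference of arctangents, which stays bounded
    as [eps] tends to [0]. *)
Let phi_Fubini (eps a b : R) : 0 < eps -> a < b ->
  [/\ integ (fun x => phi eps x * \1_(`[a, b]%classic) x),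
      integ (fun t => u t * (2 / beta *
        (atan (beta * (b - t) / eps) - atan (beta * (a - t) / eps)))) &
      \int[mu]_x (phi eps x * \1_(`[a, b]%classic) x) = \int[mu]_t (u t *
        (2 / beta * (atan (beta * (b - t) / eps) - atan (beta * (a - t) / eps))))].
Proof.
move=> eps0 ab.
pose P z := 2 * eps / (eps ^+ 2 + (beta * (z.1 - z.2)) ^+ 2).
pose F z := \1_(`[a, b]%classic) z.1 * (u z.2 * P z).
have mP : measurable_fun setT P by exact: measurable_poisson.
have mF : measurable_fun setT F.
  apply: measurable_funM.
    have m1 : measurable_fun setT (\1_(`[a, b]%classic) : R -> R).
      exact: measurable_indic.
    exact: (measurableT_comp m1).
  by apply: measurable_funM => //; exact: (measurableT_comp (integ_measurable iu)).
have P1 x : measurable_fun setT (fun t => P (x, t)).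
  by apply: measurableT_comp => //; exact: measurable_pair1.
have P2 t : measurable_fun setT (fun x => P (x, t)).
  by apply: measurableT_comp => //; exact: measurable_pair2.
have Fb x t : `|F (x, t)| <= (2 / eps * \1_(`[a, b]%classic) x) * `|u t|.
  rewrite (_ : _ * _ * _ = \1_(`[a, b]%classic) x * `|u t| * (2 / eps)); last by ring.
  rewrite /F [`|_ * _|]normrM [`|u _ * _|]normrM (ger0_norm (indic_ge0 _ _)) mulrA.
  apply: ler_wpM2l; first by rewrite mulr_ge0// indic_ge0.
  exact: poisson_kernel_bound.
have [_ _ + + +] := dominated_Fubini mF (integZ (2 / eps) (indic_itv_integ a b))
  (integ_norm iu) Fb.
rewrite (_ : (fun x => \int[mu]_y F (x, y)) =
    (fun x => phi eps x * \1_(`[a, b]%classic) x)); last first.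
  apply/funext => x; rewrite mulrC -RintegralZl//.
  apply: (@integ_bounded _ (2 / eps)) => // [|t]; first exact: P1.
  exact: poisson_kernel_bound.
rewrite (_ : (fun y => \int[mu]_x F (x, y)) = (fun t => u t * (2 / beta *
    (atan (beta * (b - t) / eps) - atan (beta * (a - t) / eps))))) //.
apply/funext => t; rewrite -Rint_poisson_itv// [in RHS]Rint_indic// -RintegralZl//.
  by apply: eq_Rintegral => x _; rewrite /F /P/= mulrCA [X in _ * X]mulrC.
have := @integ_bounded _ (2 / eps) _ (fun x => P (x, t)) (indic_itv_integ a b) (P2 t).
have h x : `|P (x, t)| <= 2 / eps by exact: poisson_kernel_bound.
move=> /(_ h); apply: integ_eq => x; exact: mulrC.
Qed.

Let atan_cvg c t : atan (beta * (c - t) / eps_ n) @[n --> \oo] -->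
  Num.sg (beta * (c - t)) * (pi / 2).
Proof.
rewrite /eps_; under eq_fun do rewrite invrK.
exact: cvg_atan_mulrn.
Qed.

(** The integral of [phi] over [[a, b]] has two limits as [eps] tends to [0]. Taken in [x], it is
    the integral of the inverse transform; taken in [t], the arctangents become signs, whose
    difference is constant for [t] inside the interval and [0] outside. *)
Lemma Rint_itv_transform (a b : R) : a < b ->
  \int[mu]_(x in `[a, b]) trig_transform beta U (\- V) x =
  2 * pi / `|beta| * \int[mu]_(t in `[a, b]) u t.
Proof.
move=> ab.
pose S := fun n => \int[mu]_x (phi (eps_ n) x * \1_(`[a, b]%classic) x).
pose K t := 2 / beta * (Num.sg (beta * (b - t)) * (pi / 2) -
  Num.sg (beta * (a - t)) * (pi / 2)).
have S1 : S n @[n --> \oo] -->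
    \int[mu]_(x in `[a, b]) trig_transform beta U (\- V) x.
  rewrite Rint_indic//.
  apply: (@Rint_dominated_cvg _ _ _ (fun x => M * \1_(`[a, b]%classic) x)).
  - by move=> n; have [/integ_measurable] := phi_Fubini (eps_gt0 n) ab.
  - by move=> x; apply: cvgM; [exact: phi_cvg|exact: cvg_cst].
  - by apply: integZ; exact: indic_itv_integ.
  - move=> n x; rewrite normrM (ger0_norm (indic_ge0 _ _)) ler_wpM2r//.
    exact: phi_bound.
pose K_ n t := 2 / beta *
    (atan (beta * (b - t) / eps_ n) - atan (beta * (a - t) / eps_ n)).
have mK n : measurable_fun setT (fun t => u t * K_ n t).
  by have [_ /integ_measurable] := phi_Fubini (eps_gt0 n) ab.
have K_K t : u t * K_ n t @[n --> \oo] --> u t * K t.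
  apply: cvgM; first exact: cvg_cst.
  apply: cvgM; first exact: cvg_cst.
  by apply: cvgB; exact: atan_cvg.
have K_b n t : `|u t * K_ n t| <= (`|2 / beta| * pi) * `|u t|.
  rewrite mulrC !normrM ler_wpM2r// -normrM ler_wpM2l//.
  rewrite (le_trans (ler_normB _ _))// [leRHS](splitr pi) lerD// norm_atan//.
have iKb := integZ (`|2 / beta| * pi) (integ_norm iu).
have S2 : S n @[n --> \oo] --> \int[mu]_t (u t * K t).
  rewrite (_ : S = fun n => \int[mu]_t (u t * K_ n t)).
    exact: (Rint_dominated_cvg mK K_K iKb K_b).
  by apply/funext => n; have [] := phi_Fubini (eps_gt0 n) ab.
rewrite (cvg_unique (@Rhausdorff R) S1 S2).
rewrite [in RHS]Rint_indic// -RintegralZl//; last first.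
  by apply: (@integ_bounded _ 1) => // x; exact: indic_norm_le1.
have iuK : integ (fun t => u t * K t).
  apply: (integ_le _ iKb); first by apply: (measurable_fun_cvg mK) => t _; exact: K_K.
  move=> t; rewrite mulrC !normrM ler_wpM2r// -normrM ler_wpM2l//.
  have pi2 : 0 <= pi / 2 :> R by rewrite divr_ge0// pi_ge0.
  have sgb (y : R) : `|Num.sg y * (pi / 2)| <= pi / 2.
    by rewrite normrM (ger0_norm pi2) ler_piMl// normr_sg; case: (_ != 0).
  by rewrite (le_trans (ler_normB _ _))// [leRHS](splitr pi) lerD.
have iu1 : integ (fun t => 2 * pi / `|beta| * (u t * \1_(`[a, b]%classic) t)).
  apply: integZ; apply: (@integ_bounded _ 1) => // x.
  exact: indic_norm_le1.
apply: (integ_ae_eq (integ_measurable iu1) iuK _).2.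
(* At an endpoint one of the signs is [0] and [K] takes half its interior value, so the equality
   fails on this null set. *)
exists [set a; b]; split.
- exact: measurableU.
- by apply: countable_lebesgue_measure0; exact: finite_set_countable.
move=> t /=; apply: contra_notP => tab.
have sgb : 2 / beta * Num.sg beta = 2 / `|beta|.
  have [b0|b0|b0] := ltgtP beta 0; last by move: beta0; rewrite b0 eqxx.
    by rewrite ltr0_sg// ltr0_norm// invrN; ring.
  by rewrite gtr0_sg// gtr0_norm// mulr1.
rewrite /K !sgrM indicE mem_setE in_itv/=.
have [ta|ta|ta] := ltgtP a t; last by exfalso; apply: tab; left.
- rewrite (ltr0_sg (x := a - t)) ?subr_lt0//.
  have [tb|tb|tb] := ltgtP t b; last by exfalso; apply: tab; right.
  + rewrite (gtr0_sg (x := b - t)) ?subr_gt0//= mulr1.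
    have -> : 2 * pi / `|beta| = 2 / beta * Num.sg beta * pi by rewrite sgb; ring.
    by field.
  + by rewrite (ltr0_sg (x := b - t)) ?subr_lt0//= subrr !mulr0.
- rewrite (gtr0_sg (x := a - t)) ?subr_gt0// (gtr0_sg (x := b - t)); last first.
    by rewrite subr_gt0 (lt_trans ta).
  by rewrite /= subrr !mulr0.
Qed.

Lemma trig_inversion :
  {ae mu, forall x, trig_transform beta U (\- V) x = 2 * pi / `|beta| * u x}.
Proof.
have iT a b : integ (fun x => trig_transform beta U (\- V) x * \1_(`[a, b]%classic) x).
  apply: (integ_le _ (integZ M (indic_itv_integ a b))).
    by apply: measurable_funM; [exact: measurable_trig_transform|exact: measurable_indic].
  move=> x; rewrite normrM (ger0_norm (indic_ge0 _ _)) ler_wpM2r//.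
  rewrite (le_trans (norm_trig_transform _ _ iU iNV))//.
  by rewrite /M; under eq_Rintegral do rewrite normrN.
have iu1 a b : integ (fun x => 2 * pi / `|beta| * (u x * \1_(`[a, b]%classic) x)).
  apply: integZ; apply: (@integ_bounded _ 1) => // x.
  exact: indic_norm_le1.
pose D x := trig_transform beta U (\- V) x - 2 * pi / `|beta| * u x.
have DE a b x : trig_transform beta U (\- V) x * \1_(`[a, b]%classic) x -
    2 * pi / `|beta| * (u x * \1_(`[a, b]%classic) x) = D x * \1_(`[a, b]%classic) x.
  by rewrite /D; ring.
have iD a b : integ (fun x => D x * \1_(`[a, b]%classic) x).
  by apply: integ_eq (integB (iT a b) (iu1 a b)) => x; exact: DE.
have D0 a b : \int[mu]_(x in `[a, b]) D x = 0.
  have [ab|ba|->] := ltgtP a b; last 2 first.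
  + by rewrite set_itv_ge ?Rintegral_set0// bnd_simp -ltNge.
  + by rewrite set_itv1 Rintegral_set1.
  rewrite Rint_indic//; under eq_Rintegral do rewrite -DE.
  rewrite RintegralB// RintegralZl//; last first.
    by apply: (@integ_bounded _ 1) => // x; exact: indic_norm_le1.
  by rewrite -!Rint_indic// Rint_itv_transform// subrr.
apply: (@filterS _ _ (ae_filter_ringOfSetsType mu)) (ae_eq0_of_itv iD D0) => x /eqP.
by rewrite subr_eq0 => /eqP.
Qed.

End inversion.

Section plancherel.
Context {R : realType}.
Notation mu := (@lebesgue_measure R).
Notation integ f := (mu.-integrable [set: R] (EFin \o f)).

Variables (beta : R) (u v : R -> R).
Hypotheses (beta0 : beta != 0) (iu : integ u) (iv : integ v).
Let U := trig_transform beta u v.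
Let V := trig_transform beta v (\- u).
Hypotheses (iU : integ U) (iV : integ V).
Let iNu : integ (\- u). Proof. exact: integN. Qed.
Let iNv : integ (\- v). Proof. exact: integN. Qed.
Let iNV : integ (\- V). Proof. exact: integN. Qed.

(** The transform of an integrable function is bounded, and a bounded integrable function is square
    integrable. *)
Lemma integ_trig_transform_sqr : integ (fun w => U w ^+ 2 + V w ^+ 2).
Proof.
apply: integD.
  have b w : `|U w| <= \int[mu]_t (`|u t| + `|v t|) by exact: norm_trig_transform.
  have := integ_bounded iU (integ_measurable iU) b.
  by apply: integ_eq => w; rewrite expr2.
have b w : `|V w| <= \int[mu]_t (`|v t| + `|(\- u) t|) by exact: norm_trig_transform.
have := integ_bounded iV (integ_measurable iV) b.
by apply: integ_eq => w; rewrite expr2.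
Qed.

(** In [trig_swap] with [p = U], [q = V], inversion replaces the transforms on the right by
    multiples of [u] and [v]. Those transforms are bounded, so their products with [u] and [v] are
    integrable; this gives the square integrability. *)
Lemma trig_Plancherel : integ (fun t => u t ^+ 2 + v t ^+ 2) /\
  \int[mu]_w (U w ^+ 2 + V w ^+ 2) =
  2 * pi / `|beta| * \int[mu]_t (u t ^+ 2 + v t ^+ 2).
Proof.
have TNN w : trig_transform beta (\- u) (\- v) w = - U w.
  rewrite -[RHS]mulN1r -RintegralZl//; last exact: integ_trig.
  by apply: eq_Rintegral => t _ /=; ring.
have aeU := trig_inversion beta0 iu iv iU iV.
(* Inversion for [- i g], whose transform has real part [V] and imaginary part [- U]. *)
have aeV : {ae mu, forall x, trig_transform beta V U x = 2 * pi / `|beta| * v x}.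
  have iNU : integ (trig_transform beta (\- u) (\- v)).
    by apply: integ_eq (integN iU) => w; rewrite TNN.
  have := trig_inversion beta0 iv iNu iV iNU.
  apply: (@filterS _ _ (ae_filter_ringOfSetsType mu)) => x <-.
  by apply: eq_trig_transform => // w; rewrite /= TNN opprK.
have bT w : `|trig_transform beta U (\- V) w| <= \int[mu]_t (`|U t| + `|(\- V) t|).
  exact: norm_trig_transform.
have bT' w : `|trig_transform beta V U w| <= \int[mu]_t (`|V t| + `|U t|).
  exact: norm_trig_transform.
have i1 := integ_bounded iu (measurable_trig_transform beta iU iNV) bT.
have i2 := integ_bounded iv (measurable_trig_transform beta iV iU) bT'.
have i12 := integD i1 i2.
have mg : measurable_fun setT (fun t => 2 * pi / `|beta| * (u t ^+ 2 + v t ^+ 2)).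
  apply: measurable_funM => //.
  by apply: measurable_funD; apply: measurable_funX; exact: integ_measurable.
have ae12 : {ae mu, forall t, u t * trig_transform beta U (\- V) t +
    v t * trig_transform beta V U t = 2 * pi / `|beta| * (u t ^+ 2 + v t ^+ 2)}.
  apply: (@filterS2 _ _ (ae_filter_ringOfSetsType mu)) aeU aeV => t -> ->.
  by ring.
have [ig eg] := integ_ae_eq mg i12 ae12.
have c0 : 2 * pi / `|beta| != 0.
  by rewrite !mulf_neq0 ?invr_neq0 ?normr_eq0// gt_eqF// pi_gt0.
have iuv : integ (fun t => u t ^+ 2 + v t ^+ 2).
  by apply: integ_eq (integZ (2 * pi / `|beta|)^-1 ig) => t; rewrite mulKf.
split => //.
by rewrite -RintegralZl// -eg -trig_swap.
Qed.

End plancherel.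

(** * The uncertainty inequality *)

Section heisenberg.
Context {R : realType}.
Notation mu := (@lebesgue_measure R).
Notation integ f := (mu.-integrable [set: R] (EFin \o f)).

Lemma sin_le_norm (x : R) : `|sin x| <= `|x|.
Proof.
have pos (y : R) : 0 < y -> `|sin y| <= `|y|.
  move=> y0.
  have [c _ +] := @MVT R (@sin R) (@cos R) 0 y y0 (fun z _ => is_derive_sin z)
    (continuous_subspaceT (@continuous_sin R)).
  by rewrite sin0 !subr0 => ->; rewrite normrM ler_piMl// cos_max.
have [x0|x0|->] := ltgtP x 0; last by rewrite sin0.
  by rewrite -normrN -sinN -(normrN x) pos// oppr_gt0.
exact: pos.
Qed.

(** The left-hand side is [|e^(i x) - 1|^2 = 4 sin^2 (x / 2)]. *)
Lemma two_sub_cos_le (x : R) : 2 - 2 * cos x <= x ^+ 2.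
Proof.
have -> : cos x = 1 - 2 * sin (x / 2) ^+ 2.
  by rewrite {1}(splitr x) cosD -!expr2 cos2sin2; ring.
have := sin_le_norm (x / 2); rewrite -ler_sqr ?nnegrE// !real_normK ?num_real//.
rewrite [in X in _ -> X](_ : x ^+ 2 = 4 * (x / 2) ^+ 2); last by field.
lra.
Qed.

Variables (beta : R) (u v : R -> R) (tm wm : R).
Hypotheses (beta0 : beta != 0) (iu : integ u) (iv : integ v).
Let U := trig_transform beta u v.
Let V := trig_transform beta v (\- u).
Hypotheses (iU : integ U) (iV : integ V).
Let iNu : integ (\- u). Proof. exact: integN. Qed.
Let iNv : integ (\- v). Proof. exact: integN. Qed.
Let rho t := u t ^+ 2 + v t ^+ 2.
Let sigma w := U w ^+ 2 + V w ^+ 2.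
Hypothesis iM : integ (fun t => (t - tm) ^+ 2 * rho t).
Hypothesis iN : integ (fun w => (w - wm) ^+ 2 * sigma w).
Let M := \int[mu]_t ((t - tm) ^+ 2 * rho t).
Let N := \int[mu]_w ((w - wm) ^+ 2 * sigma w).
Let E := \int[mu]_t rho t.
Let irho : integ rho. Proof. exact: (trig_Plancherel beta0 iu iv iU iV).1. Qed.

(** With this phase the multiplier [e^(i beta h w) - e^(i theta)] vanishes at [w = wm], which
    centres the second moment of the transform at [wm]. *)
Let theta h := beta * wm * h.
Let k1 h t := u (t + h) - (cos (theta h) * u t - sin (theta h) * v t).
Let k2 h t := v (t + h) - (sin (theta h) * u t + cos (theta h) * v t).

Let ik1 h : integ (k1 h).
Proof.
apply: integB; first exact: (integ_translate h iu).1.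
by apply: integB; exact: integZ.
Qed.

Let ik2 h : integ (k2 h).
Proof.
apply: integB; first exact: (integ_translate h iv).1.
by apply: integD; exact: integZ.
Qed.

Let A h w := cos (beta * h * w) - cos (theta h).
Let B h w := sin (beta * h * w) - sin (theta h).

(* The transform of [g(t + h) - e^(i theta) g(t)] is
   [(e^(i beta h w) - e^(i theta)) G(w)]. *)
Let Tk1 h w : trig_transform beta (k1 h) (k2 h) w = A h w * U w - B h w * V w.
Proof.
have iuh := (integ_translate h iu).1; have ivh := (integ_translate h iv).1.
have e1 := trig_transform_translate beta h w iu iv.
transitivity (trig_transform beta (fun t => u (t + h)) (fun t => v (t + h)) w -
    (cos (theta h) * U w - sin (theta h) * V w)); last first.
  by rewrite e1 /A /B -/U -/V (_ : beta * w * h = beta * h * w); ring.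
rewrite /U /V -!RintegralZl//; try exact: integ_trig.
have i1 := integZ (cos (theta h)) (@integ_trig _ beta u v w iu iv).
have i2 := integZ (sin (theta h)) (@integ_trig _ beta v (\- u) w iv iNu).
rewrite -RintegralB// -RintegralB//; last 2 first.
- exact: (@integ_trig _ beta (fun t => u (t + h)) (fun t => v (t + h))).
- exact: integB.
by apply: eq_Rintegral => t _; rewrite /k1 /k2 /=; ring.
Qed.

Let Tk2 h w : trig_transform beta (k2 h) (\- k1 h) w = A h w * V w + B h w * U w.
Proof.
have iuh := (integ_translate h iNu).1; have ivh := (integ_translate h iv).1.
have e1 := trig_transform_translate beta h w iv iNu.
have TN : trig_transform beta (\- u) (\- v) w = - U w.
  rewrite -[RHS]mulN1r -RintegralZl//; last exact: integ_trig.
  by apply: eq_Rintegral => t _ /=; ring.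
transitivity (trig_transform beta (fun t => v (t + h)) (fun t => - u (t + h)) w -
    (sin (theta h) * U w + cos (theta h) * V w)); last first.
  by rewrite e1 TN /A /B -/U -/V (_ : beta * w * h = beta * h * w); ring.
rewrite /U /V -!RintegralZl//; try exact: integ_trig.
have i1 := integZ (sin (theta h)) (@integ_trig _ beta u v w iu iv).
have i2 := integZ (cos (theta h)) (@integ_trig _ beta v (\- u) w iv iNu).
rewrite -RintegralD// -RintegralB//; last 2 first.
- exact: (@integ_trig _ beta (fun t => v (t + h)) (fun t => - u (t + h))).
- exact: integD.
by apply: eq_Rintegral => t _; rewrite /k1 /k2 /=; ring.
Qed.

Let mA h : measurable_fun setT (A h).
Proof. by apply: measurable_funB => //; exact: measurable_cosM. Qed.

Let mB h : measurable_fun setT (B h).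
Proof. by apply: measurable_funB => //; exact: measurable_sinM. Qed.

Let A2 h w : `|A h w| <= 2.
Proof. by rewrite (le_trans (ler_normB _ _))// (_ : 2 = 1 + 1)// lerD// cos_max. Qed.

Let B2 h w : `|B h w| <= 2.
Proof. by rewrite (le_trans (ler_normB _ _))// (_ : 2 = 1 + 1)// lerD// sin_max. Qed.

Let iTk1 h : integ (trig_transform beta (k1 h) (k2 h)).
Proof.
have i1 := integ_bounded iU (mA h) (A2 h); have i2 := integ_bounded iV (mB h) (B2 h).
by apply: integ_eq (integB i1 i2) => w; rewrite Tk1; ring.
Qed.

Let iTk2 h : integ (trig_transform beta (k2 h) (\- k1 h)).
Proof.
have i1 := integ_bounded iV (mA h) (A2 h); have i2 := integ_bounded iU (mB h) (B2 h).
by apply: integ_eq (integD i1 i2) => w; rewrite Tk2; ring.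
Qed.

(** The left-hand side is the squared modulus of [e^(i beta h w) - e^(i theta)], that is
    [2 - 2 cos (beta * h * (w - wm))]. *)
Let AB h w : A h w ^+ 2 + B h w ^+ 2 <= (beta * h) ^+ 2 * (w - wm) ^+ 2.
Proof.
have := two_sub_cos_le (beta * h * w - theta h).
rewrite cosB (_ : _ - theta h = beta * h * (w - wm)); last by rewrite /theta; ring.
rewrite exprMn; apply: le_trans; rewrite le_eqVlt; apply/orP; left; apply/eqP.
rewrite /A /B !sqrrB.
have := cos2Dsin2 (beta * h * w); have := cos2Dsin2 (theta h).
by move=> /(canRL (addrK _)) -> /(canRL (addrK _)) ->; ring.
Qed.

Let k_bound h : integ (fun t => k1 h t ^+ 2 + k2 h t ^+ 2) /\
  2 * pi / `|beta| * \int[mu]_t (k1 h t ^+ 2 + k2 h t ^+ 2) <= (beta * h) ^+ 2 * N.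
Proof.
have [ik2' <-] := trig_Plancherel beta0 (ik1 h) (ik2 h) (iTk1 h) (iTk2 h).
split => //; rewrite -RintegralZl//; apply: le_Rintegral => //.
- exact: (integ_trig_transform_sqr (ik1 h) (ik2 h) (iTk1 h) (iTk2 h)).
- exact: integZ.
move=> w _; rewrite Tk1 Tk2 mulrA.
have -> : (A h w * U w - B h w * V w) ^+ 2 + (A h w * V w + B h w * U w) ^+ 2 =
   (A h w ^+ 2 + B h w ^+ 2) * sigma w by rewrite /sigma; ring.
by apply: ler_wpM2r; [rewrite addr_ge0 ?sqr_ge0|exact: AB].
Qed.

(** The integral of [|k_h|^2] is of order [h^2], so the weights of order [1 / h] and [h] make both
    terms on the right of order [h] once integrated, like the [h * E] that the left-hand side gives.
    [lambda] is left free for a final optimisation. *)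
Let pointwise lambda h t : 0 < lambda -> 0 < h ->
  (t - tm) * rho t - (t - tm) * rho (t + h) <=
  lambda / (2 * h) * (k1 h t ^+ 2 + k2 h t ^+ 2) +
  h / lambda * ((t - tm) ^+ 2 * rho t + (t - tm) ^+ 2 * rho (t + h)).
Proof.
move=> l0 h0.
pose c := cos (theta h); pose s := sin (theta h).
have cs : c ^+ 2 = 1 - s ^+ 2 by rewrite -(cos2Dsin2 (theta h)) addrK.
pose y1 := u (t + h) + (c * u t - s * v t).
pose y2 := v (t + h) + (s * u t + c * v t).
pose x1 := k1 h t; pose x2 := k2 h t; pose r := t - tm.
(* A difference of squares: [x1 + i x2] and [y1 + i y2] are the difference and the sum of [g(t + h)]
   and [e^(i theta) g(t)], and the rotation by [theta] preserves [rho t]. *)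
have e1 : rho t - rho (t + h) = - (x1 * y1 + x2 * y2).
  rewrite /rho /x1 /x2 /y1 /y2 /k1 /k2 -/c -/s.
  have -> : u t ^+ 2 + v t ^+ 2 = (c ^+ 2 + s ^+ 2) * (u t ^+ 2 + v t ^+ 2).
    by rewrite cs subrK mul1r.
  ring.
(* The parallelogram law. Only the part in [y1], [y2] is needed; [p3] below discards the part in
   [x1], [x2]. *)
have e2 : 2 * (rho t + rho (t + h)) = x1 ^+ 2 + x2 ^+ 2 + (y1 ^+ 2 + y2 ^+ 2).
  rewrite /rho /x1 /x2 /y1 /y2 /k1 /k2 -/c -/s.
  have -> : u t ^+ 2 + v t ^+ 2 = (c ^+ 2 + s ^+ 2) * (u t ^+ 2 + v t ^+ 2).
    by rewrite cs subrK mul1r.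
  ring.
rewrite -mulrBr -mulrDr e1 -/r -/x1 -/x2.
have r2 : 0 <= r ^+ 2 * (x1 ^+ 2 + x2 ^+ 2) by rewrite mulr_ge0 ?addr_ge0 ?sqr_ge0.
have hl : 0 < h / lambda by rewrite divr_gt0.
have q (x y : R) : - (r * (x * y)) <=
    lambda / (2 * h) * x ^+ 2 + h / (2 * lambda) * (r ^+ 2 * y ^+ 2).
  rewrite -subr_ge0 (_ : _ - _ = (lambda * x + h * r * y) ^+ 2 / (2 * h * lambda)).
    by rewrite divr_ge0 ?sqr_ge0// !mulr_ge0// ltW.
  by field; rewrite !gt_eqF.
have := lerD (q x1 y1) (q x2 y2).
have -> : rho t + rho (t + h) = (x1 ^+ 2 + x2 ^+ 2 + (y1 ^+ 2 + y2 ^+ 2)) / 2.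
  by rewrite -e2; field.
have p3 : 0 <= h / lambda * (r ^+ 2 * (x1 ^+ 2 + x2 ^+ 2)) / 2.
  by rewrite divr_ge0// mulr_ge0// ltW.
have e3 : h / (2 * lambda) = h / lambda / 2 by field; rewrite gt_eqF.
rewrite e3.
lra.
Qed.

Let M1 := \int[mu]_t ((t - tm) * rho t).

Let mrho : measurable_fun setT rho. Proof. exact: integ_measurable irho. Qed.

Let iM1 : integ (fun t => (t - tm) * rho t).
Proof.
apply: (integ_le _ (integD irho iM)) => [|t].
  by apply: measurable_funM => //; exact: measurable_funB.
have r0 : 0 <= rho t by rewrite addr_ge0 ?sqr_ge0.
rewrite normrM (ger0_norm r0) -[X in _ <= X + _]mul1r -mulrDl ler_wpM2r//.
have := sqr_ge0 (`|t - tm| - 1); rewrite sqrrB real_normK ?num_real//.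
have := normr_ge0 (t - tm); lra.
Qed.

(** The integral of [pointwise], multiplied by [lambda / h]. The first moments on the left cancel up
    to [h * E]. On the right, [\int |k_h|^2] is at most [|beta|^3 / (2 * pi) * h^2 * N], and its
    weight [lambda^2 / (2 * h^2)] produces the [4 * pi]. *)
Let heisenberg_h lambda h : 0 < lambda -> 0 < h ->
  E * lambda <= `|beta| ^+ 3 / (4 * pi) * N * lambda ^+ 2 + 2 * M -
    2 * (h * M1) + h ^+ 2 * E.
Proof.
move=> l0 h0; have [ik bk] := k_bound h.
have pi0 : 0 < pi :> R by exact: pi_gt0.
have b0 : 0 < `|beta| by rewrite normr_gt0.
(* [is1] and [is2] are chosen so that their translates by [h] are [(t - tm) * rho (t + h)] and
   [(t - tm)^2 * rho (t + h)]. *)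
have is1 : integ (fun t => (t - tm) * rho t - h * rho t).
  by apply: integB => //; exact: integZ.
have is2 : integ (fun t => (t - tm) ^+ 2 * rho t - 2 * h * ((t - tm) * rho t) +
    h ^+ 2 * rho t).
  by apply: integD; [apply: integB => //|]; exact: integZ.
have [it1 e1] := integ_translate h is1; have [it2 e2] := integ_translate h is2.
have f1 t : (t + h - tm) * rho (t + h) - h * rho (t + h) = (t - tm) * rho (t + h).
  by ring.
have f2 t : (t + h - tm) ^+ 2 * rho (t + h) - 2 * h * ((t + h - tm) * rho (t + h)) +
    h ^+ 2 * rho (t + h) = (t - tm) ^+ 2 * rho (t + h) by ring.
have jt1 : integ (fun t => (t - tm) * rho (t + h)) by exact: integ_eq f1 it1.
have jt2 : integ (fun t => (t - tm) ^+ 2 * rho (t + h)) by exact: integ_eq f2 it2.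
have g1 : \int[mu]_t ((t - tm) * rho (t + h)) = M1 - h * E.
  rewrite /M1 /E -RintegralZl// -RintegralB//; last exact: integZ.
  by rewrite -e1; apply: eq_Rintegral => t _; rewrite f1.
have g2 : \int[mu]_t ((t - tm) ^+ 2 * rho (t + h)) = M - 2 * h * M1 + h ^+ 2 * E.
  rewrite /M /M1 /E -!RintegralZl// -RintegralB//; last exact: integZ.
  rewrite -RintegralD//; last 2 first.
  - by apply: integB => //; exact: integZ.
  - exact: integZ.
  by rewrite -e2; apply: eq_Rintegral => t _; rewrite f2.
have ir := integZ (h / lambda) (integD iM jt2).
have il := integZ (lambda / (2 * h)) ik.
have := @le_Rintegral _ _ _ mu setT _ _ measurableT (integB iM1 jt1) (integD il ir)
  (fun t _ => pointwise t l0 h0).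
rewrite RintegralB// g1 RintegralD//.
rewrite RintegralZl// RintegralZl//; last exact: integD.
rewrite RintegralD// g2 -/M -/M1.
set I := \int[mu]_t (k1 h t ^+ 2 + _) in bk *.
rewrite (_ : M1 - (M1 - h * E) = h * E); last by ring.
have {}bk : I <= `|beta| ^+ 3 * h ^+ 2 * N / (2 * pi).
  rewrite ler_pdivlMr ?mulr_gt0//.
  have := bk; rewrite mulrAC ler_pdivrMr//.
  rewrite (_ : (beta * h) ^+ 2 * N * `|beta| = `|beta| ^+ 3 * h ^+ 2 * N).
    by rewrite [I * _]mulrC.
  by rewrite exprMn -[beta ^+ 2]real_normK ?num_real//; ring.
move=> hE.
have lh : 0 < lambda / h by rewrite divr_gt0.
have := ler_wpM2l (ltW lh) hE.
have -> : lambda / h * (h * E) = E * lambda by field; rewrite gt_eqF.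
move=> /le_trans; apply.
rewrite mulrDr -!addrA; apply: lerD.
  have -> : lambda / h * (lambda / (2 * h) * I) = lambda ^+ 2 / (2 * h ^+ 2) * I.
    by field; rewrite gt_eqF.
  have c0 : 0 <= lambda ^+ 2 / (2 * h ^+ 2).
    by apply: divr_ge0; [exact: sqr_ge0|apply: mulr_ge0 => //; exact: sqr_ge0].
  apply: (le_trans (ler_wpM2l c0 bk)); rewrite le_eqVlt; apply/orP; left; apply/eqP.
  (* [field] would unfold [pi], which is therefore generalized. *)
  by move: pi0; move: (@pi R) => P P0; field; rewrite !gt_eqF.
rewrite le_eqVlt; apply/orP; left; apply/eqP.
by field; rewrite !gt_eqF.
Qed.

Lemma heisenberg_lambda lambda : 0 < lambda ->
  E * lambda <= `|beta| ^+ 3 / (4 * pi) * N * lambda ^+ 2 + 2 * M.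
Proof.
move=> l0; rewrite leNgt; apply/negP => lt.
set d := E * lambda; set Y := _ + 2 * M in lt.
(* For [h <= 1] the terms containing [h] amount to at most [h * K], so a gap [d - Y > 0] is
   contradicted by any [h] with [h * K < d - Y]. The denominator below has [K + 1] because [K] may
   be [0]. *)
pose K := 2 * `|M1| + E.
have E0 : 0 <= E by apply: Rintegral_ge0 => t _; rewrite addr_ge0 ?sqr_ge0.
have K0 : 0 <= K by rewrite addr_ge0// mulr_ge0.
have K1 : 0 < K + 1 by rewrite ltr_wpDl.
have dY : 0 < d - Y by rewrite subr_gt0.
pose h := Num.min 1 ((d - Y) / (2 * (K + 1))).
have h0 : 0 < h by rewrite lt_min ltr01 divr_gt0// mulr_gt0.
have h1 : h <= 1 by rewrite ge_min lexx.
have hK : h * K < d - Y.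
  have : h <= (d - Y) / (2 * (K + 1)) by rewrite ge_min lexx orbT.
  rewrite ler_pdivlMr ?mulr_gt0// => hd.
  have : 0 < h * (K + 2) by rewrite mulr_gt0// ltr_wpDl.
  by lra.
have := heisenberg_h l0 h0; rewrite -/d -/Y.
have : - (h * M1) <= h * `|M1|.
  by rewrite -mulrN ler_wpM2l ?(ltW h0)// -normrN ler_norm.
have : h ^+ 2 * E <= h * E by rewrite ler_wpM2r// expr2 ler_piMl// ltW.
by rewrite /K in hK; lra.
Qed.

(** The quadratic [a * lambda^2 - E * lambda + 2 * M] is nonnegative for all [lambda > 0]; at its
    minimum [lambda = E / (2 * a)] this reads [E^2 <= 8 * a * M]. *)
Lemma heisenberg : E ^+ 2 <= 2 * `|beta| ^+ 3 / pi * N * M.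
Proof.
have E0 : 0 <= E by apply: Rintegral_ge0 => t _; rewrite addr_ge0 ?sqr_ge0.
have M0 : 0 <= M.
  by apply: Rintegral_ge0 => t _; rewrite mulr_ge0 ?addr_ge0 ?sqr_ge0.
have N0 : 0 <= N.
  by apply: Rintegral_ge0 => t _; rewrite mulr_ge0 ?addr_ge0 ?sqr_ge0.
have pi0 : 0 < pi :> R by exact: pi_gt0.
pose a := `|beta| ^+ 3 / (4 * pi) * N.
have a0 : 0 <= a by rewrite mulr_ge0// divr_ge0 ?mulr_ge0 ?exprn_ge0 ?(ltW pi0).
rewrite (_ : _ * M = 8 * a * M); last first.
  by rewrite /a; move: pi0; move: (@pi R) => P P0; field; rewrite gt_eqF.
move: E0; rewrite le_eqVlt => /orP[/eqP <-|E0].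
  by rewrite expr0n/=; apply: mulr_ge0 => //; exact: mulr_ge0.
move: (a0); rewrite le_eqVlt => /orP[/eqP a0'|a1].
  (* With [a = 0] the bound is linear in [lambda], and this value turns it into
     [2 * M + 1 <= 2 * M]. *)
  have l0 : 0 < (2 * M + 1) / E by rewrite divr_gt0// ltr_wpDl// mulr_ge0.
  have := heisenberg_lambda l0.
  rewrite -/a -a0' mul0r add0r.
  have -> : E * ((2 * M + 1) / E) = 2 * M + 1 by field; rewrite gt_eqF.
  by move=> h; exfalso; lra.
have l0 : 0 < E / (2 * a) by rewrite divr_gt0// mulr_gt0.
have := heisenberg_lambda l0; rewrite -/a.
have -> : E * (E / (2 * a)) = E ^+ 2 / (2 * a) by rewrite mulrA -expr2.
have -> : a * (E / (2 * a)) ^+ 2 = E ^+ 2 / (2 * a) / 2 by field; rewrite gt_eqF.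
have : E ^+ 2 = E ^+ 2 / (2 * a) * (2 * a) by rewrite divfK// gt_eqF// mulr_gt0.
set X := E ^+ 2 / (2 * a) => -> h.
have h2 : X <= 4 * M by lra.
have := ler_wpM2r (_ : 0 <= 2 * a) h2; rewrite mulr_ge0// => /(_ isT) h3.
by apply: (le_trans h3); lra.
Qed.

End heisenberg.

(** * Jensen's inequality for power moments *)

Section jensen.
Context {R : realType}.
Notation mu := (@lebesgue_measure R).
Notation integ f := (mu.-integrable [set: R] (EFin \o f)).

(** Convexity of the power function, read off Young's inequality for [y] and [x^(r - 1)] with
    exponents [r] and [r / (r - 1)]. At [r = 1] the conjugate exponent degenerates and the claim is
    an equality. *)
Lemma powR_tangent (r x y : R) : 1 <= r -> 0 <= y -> 0 < x ->
  x `^ r + r * x `^ (r - 1) * (y - x) <= y `^ r.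
Proof.
rewrite le_eqVlt => /orP[/eqP <- y0 x0|r1 y0 x0].
  by rewrite subrr powRr0 !powRr1 ?(ltW x0)// !mul1r addrC subrK.
have r0 : 0 < r by exact: lt_trans r1.
have r10 : 0 < r - 1 by rewrite subr_gt0.
pose q := r / (r - 1).
have q0 : 0 < q by rewrite divr_gt0.
have rq : r^-1 + q^-1 = 1.
  by rewrite /q; field; rewrite !gt_eqF.
have := conjugate_powR y0 (powR_ge0 x (r - 1)) r0 q0 rq.
have -> : (x `^ (r - 1)) `^ q = x `^ r.
  by rewrite -powRrM /q; congr (x `^ _); field; rewrite gt_eqF.
move=> /(ler_wpM2l (ltW r0)).
have -> : r * (y `^ r / r + x `^ r / q) = y `^ r + (r - 1) * x `^ r.
  by rewrite /q; field; rewrite !gt_eqF.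
have xr : x `^ (r - 1) * x = x `^ r.
  rewrite -[X in _ * X = _](powRr1 (ltW x0)) -powRD ?subrK//.
  by rewrite gt_eqF//= implybT.
rewrite -xr; lra.
Qed.

Lemma powR_sqr (p y : R) : `|y| `^ p = (y ^+ 2) `^ (p / 2).
Proof.
by rewrite -real_normK ?num_real// -powR_mulrn// -powRrM mulrC divfK.
Qed.

(** This lets the mass and the [p]-th moment control the second moment. For [y^2 >= 1] it comes from
    the tangent at [1] for the exponent [p / 2], whose slope is at least [1]; otherwise the summand
    [1] suffices. *)
Lemma sqr_le_powR (p y : R) : 2 <= p -> y ^+ 2 <= 1 + `|y| `^ p.
Proof.
move=> p2; have := @powR_tangent (p / 2) 1 (y ^+ 2).
rewrite ler_pdivlMr// mul1r => /(_ p2 (sqr_ge0 _) ltr01).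
rewrite !powR1 mulr1 -powR_sqr => le_y.
have [y1|y1] := leP 1 (y ^+ 2); last first.
  by rewrite (le_trans (ltW y1))// lerDl powR_ge0.
have h : 0 <= (p / 2 - 1) * (y ^+ 2 - 1).
  by rewrite mulr_ge0// subr_ge0// ler_pdivlMr// mul1r.
by lra.
Qed.

Variables (rho : R -> R) (p x0 : R).
Hypotheses (p2 : 2 <= p) (rho0 : forall x, 0 <= rho x) (irho : integ rho).
Hypothesis ip : integ (fun x => `|x - x0| `^ p * rho x).

Lemma integ_moment2 : integ (fun x => (x - x0) ^+ 2 * rho x).
Proof.
apply: (integ_le _ (integD irho ip)) => [|x].
  apply: measurable_funM; last exact: integ_measurable.
  by apply: measurable_funX; exact: measurable_funB.
have y0 : 0 <= (x - x0) ^+ 2 * rho x by apply: mulr_ge0 => //; exact: sqr_ge0.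
rewrite (ger0_norm y0) -[X in _ <= X + _]mul1r -mulrDl; apply: ler_wpM2r => //.
exact: sqr_le_powR.
Qed.

(* Integrate the tangent line inequality at the mean [M2 / E]. *)
Lemma moment_jensen (E := \int[mu]_x rho x)
    (M2 := \int[mu]_x ((x - x0) ^+ 2 * rho x)) :
  0 < E -> E * (M2 / E) `^ (p / 2) <= \int[mu]_x (`|x - x0| `^ p * rho x).
Proof.
move=> E0.
have M20 : 0 <= M2 by apply: Rintegral_ge0 => x _; rewrite mulr_ge0 ?sqr_ge0.
have p0 : 0 < p / 2 by rewrite divr_gt0// (lt_le_trans _ p2).
move: M20; rewrite le_eqVlt => /orP[/eqP <-|M20].
  rewrite mul0r powR0 ?gt_eqF// mulr0.
  by apply: Rintegral_ge0 => x _; rewrite mulr_ge0// powR_ge0.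
pose m := M2 / E; have m0 : 0 < m by rewrite divr_gt0.
pose k := p / 2 * m `^ (p / 2 - 1).
have i1 := integZ k integ_moment2; have i2 := integZ (m `^ (p / 2) - k * m) irho.
have := @le_Rintegral _ _ _ mu setT _ _ measurableT (integD i1 i2) ip _.
rewrite RintegralD// RintegralZl//; last exact: integ_moment2.
rewrite RintegralZl// -/E -/M2 => h.
have -> : E * (M2 / E) `^ (p / 2) = k * M2 + (m `^ (p / 2) - k * m) * E.
  by rewrite /m; field; rewrite gt_eqF.
apply: h => x _; rewrite mulrA -mulrDl; apply: ler_wpM2r => //.
rewrite powR_sqr; apply: le_trans (powR_tangent _ (sqr_ge0 (x - x0)) m0).
  by rewrite -/k le_eqVlt; apply/orP; left; apply/eqP; ring.
by rewrite ler_pdivlMr// mul1r.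
Qed.

End jensen.

(** * From second moments to moments of order [p] *)

Section moments.
Context {R : realType}.
Notation mu := (@lebesgue_measure R).
Notation integ f := (mu.-integrable [set: R] (EFin \o f)).
Variables (beta p tm wm : R) (u v : R -> R).
Hypotheses (beta0 : beta != 0) (p2 : 2 <= p) (iu : integ u) (iv : integ v).
Let U := trig_transform beta u v.
Let V := trig_transform beta v (\- u).
Hypotheses (iU : integ U) (iV : integ V).
Let rho t := u t ^+ 2 + v t ^+ 2.
Let sigma w := `|beta| / (2 * pi) * (U w ^+ 2 + V w ^+ 2).
Hypothesis iMf : integ (fun t => `|t - tm| `^ p * rho t).
Hypothesis iMg : integ (fun w => `|w - wm| `^ p * sigma w).

(** Let [N'] be the second moment of [sigma]. Both densities have mass [E], so Jensen's inequality
    bounds the product below by [E^2 * (M * N' / E^2)^(p / 2)]. As [N' = |beta| / (2 * pi) * N],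
    [heisenberg] says that [M * N' / E^2] is at least [(2 * |beta|)^(- 2)]. *)
Lemma moment_product :
  (\int[mu]_t rho t) ^+ 2 * ((2 * `|beta|) ^-1) `^ p <=
  \int[mu]_t (`|t - tm| `^ p * rho t) * \int[mu]_w (`|w - wm| `^ p * sigma w).
Proof.
have pi0 : 0 < pi :> R by exact: pi_gt0.
have b0 : 0 < `|beta| by rewrite normr_gt0.
have c0 : 0 < `|beta| / (2 * pi) by rewrite divr_gt0// mulr_gt0.
have [irho ePl] := trig_Plancherel beta0 iu iv iU iV.
have iUV := integ_trig_transform_sqr iu iv iU iV.
have rho0 t : 0 <= rho t by rewrite addr_ge0 ?sqr_ge0.
have sigma0 w : 0 <= sigma w.
  by apply: mulr_ge0; [exact: ltW|rewrite addr_ge0 ?sqr_ge0].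
have isigma : integ sigma by exact: integZ.
set E := \int[mu]_t rho t.
have Es : \int[mu]_w sigma w = E.
  rewrite RintegralZl// ePl /E; move: pi0; move: (@pi R) => P P0; field.
  by rewrite !gt_eqF.
have E0 : 0 <= E by exact: Rintegral_ge0.
have p0 : p != 0 by rewrite gt_eqF// (lt_le_trans _ p2).
move: E0; rewrite le_eqVlt => /orP[/eqP <-|E0].
  rewrite expr0n/= mul0r mulr_ge0//; apply: Rintegral_ge0 => t _;
    by rewrite mulr_ge0// powR_ge0.
have J1 := moment_jensen p2 rho0 irho iMf E0.
have J2 := moment_jensen p2 sigma0 isigma iMg.
rewrite Es in J2; move/(_ E0) in J2.
have im1 := integ_moment2 p2 rho0 irho iMf.
have im2 : integ (fun w => (w - wm) ^+ 2 * (U w ^+ 2 + V w ^+ 2)).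
  have := integZ (`|beta| / (2 * pi))^-1 (integ_moment2 p2 sigma0 isigma iMg).
  apply: integ_eq => w; rewrite /sigma; move: pi0; move: (@pi R) => P P0; field.
  by rewrite !gt_eqF.
have H := heisenberg beta0 iu iv iU iV im1 im2.
rewrite -/E in H.
set M := \int[mu]_t ((t - tm) ^+ 2 * _) in H.
set N := \int[mu]_w _ in H.
have Ns : \int[mu]_w ((w - wm) ^+ 2 * sigma w) = `|beta| / (2 * pi) * N.
  by rewrite -RintegralZl//; apply: eq_Rintegral => w _; rewrite /sigma mulrCA.
rewrite Ns in J2; rewrite -/M in J1.
have M0 : 0 <= M.
  by apply: Rintegral_ge0 => t _; rewrite mulr_ge0 ?sqr_ge0 ?addr_ge0 ?sqr_ge0.
have N0 : 0 <= N.
  by apply: Rintegral_ge0 => t _; rewrite mulr_ge0 ?sqr_ge0 ?addr_ge0 ?sqr_ge0.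
have x1 : 0 <= M / E by rewrite divr_ge0// ltW.
have x2 : 0 <= `|beta| / (2 * pi) * N / E.
  by apply: divr_ge0; [apply: mulr_ge0 => //|]; exact: ltW.
have l1 : 0 <= E * (M / E) `^ (p / 2) by rewrite mulr_ge0 ?powR_ge0// ltW.
have l2 : 0 <= E * (`|beta| / (2 * pi) * N / E) `^ (p / 2).
  by rewrite mulr_ge0 ?powR_ge0// ltW.
apply: le_trans (ler_pM l1 l2 J1 J2).
rewrite mulrACA -expr2 -powRM// ler_wpM2l ?sqr_ge0//.
have b2 : 0 <= (2 * `|beta|)^-1 by rewrite invr_ge0 mulr_ge0.
rewrite -(ger0_norm b2) powR_sqr.
have p20 : 0 <= p / 2 by rewrite divr_ge0// (le_trans _ p2).
apply: (ge0_ler_powR p20); rewrite ?nnegrE; [exact: sqr_ge0|exact: mulr_ge0|].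
have -> : M / E * (`|beta| / (2 * pi) * N / E) =
    2 * `|beta| ^+ 3 / pi * N * M / (E ^+ 2 * (2 * `|beta|) ^+ 2).
  by move: pi0; move: (@pi R) => P P0; field; rewrite !gt_eqF.
rewrite ler_pdivlMr; last by rewrite mulr_gt0 ?exprn_gt0 ?mulr_gt0.
apply: le_trans H; rewrite le_eqVlt; apply/orP; left; apply/eqP.
by move: pi0; move: (@pi R) => P P0; field; rewrite gt_eqF.
Qed.

End moments.

(** * The offset linear canonical transform *)

Section ae_nonmeasurable.
Context d (T : measurableType d) (R : realType).
Variable mu : {measure set T -> \bar R}.
Import HBNNSimple.
Local Open Scope ereal_scope.

(* A simple function below [F], set to [0] on the null set where [F] and [G]
   differ, stays below [G]. *)
Let ge0_ae_le_integral (F G : T -> \bar R) :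
  (forall x, 0 <= F x) -> (forall x, 0 <= G x) ->
  {ae mu, forall x, F x = G x} -> \int[mu]_x F x <= \int[mu]_x G x.
Proof.
move=> F0 G0 [N [mN N0 FG]].
rewrite ge0_integralTE// ge0_integralTE//.
apply: ge_ereal_sup => _ [h /= hF <-].
have mNC : measurable (~` N) by exact: measurableC.
apply: (@le_trans _ _ (sintegral mu (proj_nnsfun h mNC))).
  rewrite -!integralT_nnsfun le_eqVlt; apply/orP; left; apply/eqP.
  apply: ge0_ae_eq_integral => //=.
  - exact/measurable_EFinP.
  - by apply/measurable_EFinP; exact: measurable_funP (proj_nnsfun h mNC).
  - by move=> x _; rewrite lee_fin; exact: fun_ge0.
  - by move=> x _; rewrite lee_fin mindicE; apply: mulr_ge0; [exact: fun_ge0|exact: ler0n].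
  exists N; split => // x /=; apply: contra_notP => Nx _.
  by rewrite mindicE mem_set ?mulr1.
apply: ereal_sup_ubound; exists (proj_nnsfun h mNC) => //= x.
rewrite mindicE; have [xN|xN] := pselect (N x).
  by rewrite memNset ?mulr0// => /(_ xN).
rewrite mem_set// mulr1 (le_trans (hF x))//.
have -> : F x = G x by apply: contrapT => FGx; apply: xN; exact: FG.
by [].
Qed.

(** [f] only agrees almost everywhere with a Borel function, so this is what carries its transform,
    energy and moments over to that representative. *)
Lemma ae_eq_integral_nonmeasurable (F G : T -> \bar R) :
  {ae mu, forall x, F x = G x} -> \int[mu]_x F x = \int[mu]_x G x.
Proof.
move=> FG.
have GF : {ae mu, forall x, G x = F x}.
  by apply: (@filterS _ _ (ae_filter_ringOfSetsType mu)) FG => x ->.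
rewrite integralE [RHS]integralE; congr (_ - _); apply/eqP; rewrite eq_le.
  by apply/andP; split; apply: ge0_ae_le_integral => //;
    [apply: (@filterS _ _ (ae_filter_ringOfSetsType mu)) FG
    |apply: (@filterS _ _ (ae_filter_ringOfSetsType mu)) GF] => x Fx;
  rewrite funeposE [RHS]funeposE Fx.
by apply/andP; split; apply: ge0_ae_le_integral => //;
    [apply: (@filterS _ _ (ae_filter_ringOfSetsType mu)) FG
    |apply: (@filterS _ _ (ae_filter_ringOfSetsType mu)) GF] => x Fx;
  rewrite funenegE [RHS]funenegE Fx.
Qed.

End ae_nonmeasurable.

Section olct.
Context {R : realType}.
Notation mu := (@lebesgue_measure R).
Notation integ f := (mu.-integrable [set: R] (EFin \o f)).
Implicit Types (f g h : R -> R[i]) (z : R[i]).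

Lemma cabs_sqr z : cabs z ^+ 2 = complex.Re z ^+ 2 + complex.Im z ^+ 2.
Proof. by case: z => x y; rewrite sqr_sqrtr// addr_ge0 ?sqr_ge0. Qed.

Lemma cabs_ge0 z : 0 <= cabs z.
Proof. by case: z => x y; exact: sqrtr_ge0. Qed.

Lemma cabsE z : cabs z = Num.sqrt (complex.Re z ^+ 2 + complex.Im z ^+ 2).
Proof. by case: z. Qed.

Lemma eq_cintegral_ae f g : {ae mu, forall x, f x = g x} ->
  cintegral f = cintegral g.
Proof.
move=> fg; rewrite /cintegral /Rintegral.
congr (Complex (fine _) (fine _)); apply: ae_eq_integral_nonmeasurable;
  by apply: (@filterS _ _ (ae_filter_ringOfSetsType mu)) fg => x /= ->.
Qed.

Lemma in_Lspace1 f : in_Lspace 1%:E f -> exists h, [/\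
  integ (fun x => complex.Re (h x)), integ (fun x => complex.Im (h x)),
  integ (fun x => cabs (h x)) & {ae mu, forall x, f x = h x}].
Proof.
move=> [h [mRe mIm fin fh]]; exists h.
have mc : measurable_fun setT (fun x => cabs (h x)).
  under eq_fun do rewrite cabsE.
  apply: measurableT_comp; first by apply: continuous_measurable_fun; exact: sqrt_continuous.
  by apply: measurable_funD; exact: measurable_funX.
have ic : integ (fun x => cabs (h x)).
  apply/integrableP; split; first exact/measurable_EFinP.
  by move: fin; rewrite /finite_norm Lnorm1.
split => //; apply: (integ_le _ ic) => // x; rewrite cabsE -sqrtr_sqr ler_wsqrtr//.
  by rewrite lerDl sqr_ge0.
by rewrite lerDr sqr_ge0.
Qed.

(** Squaring the modulus removes the choice of branch and the sign of [b]: the squared modulus of a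
    square root of [z] is [|z|]. *)
Lemma cabs_OLCT_const (b chi : R) : b != 0 ->
  cabs ((sqrtc (Complex 0 (2 * pi * b)))^-1 * expj chi) ^+ 2 = `|b^-1| / (2 * pi).
Proof.
move=> b0; have pi0 : 0 < pi :> R by exact: pi_gt0.
rewrite /cabs ComplexField.Normc.normcM ComplexField.Normc.normcV.
have -> : ComplexField.Normc.normc (expj chi) = 1.
  by rewrite /= cos2Dsin2 sqrtr1.
rewrite mulr1 exprVn expr2 -ComplexField.Normc.normcM -expr2 sqr_sqrtc /=.
rewrite expr0n/= add0r sqrtr_sqr normrM ger0_norm ?mulr_ge0 ?(ltW pi0)//.
by rewrite invfM normfV mulrC.
Qed.

Section transform.
Variables (a b d tau eta : R) (h : R -> R[i]).
Hypotheses (iRe : integ (fun x => complex.Re (h x)))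
  (iIm : integ (fun x => complex.Im (h x))).

Let psi (t : R) := a / (2 * b) * t ^+ 2 + b^-1 * tau * t.

(* [chirp_re + i chirp_im] is [h] times the unimodular factor of the kernel that
   depends on [t] alone. *)
Definition chirp_re (t : R) :=
  complex.Re (h t) * cos (psi t) - complex.Im (h t) * sin (psi t).
Definition chirp_im (t : R) :=
  complex.Re (h t) * sin (psi t) + complex.Im (h t) * cos (psi t).

Lemma chirp_sqr t : chirp_re t ^+ 2 + chirp_im t ^+ 2 = cabs (h t) ^+ 2.
Proof.
rewrite cabs_sqr /chirp_re /chirp_im.
rewrite -[RHS]mulr1 -(cos2Dsin2 (psi t)); ring.
Qed.

Let mpsi : measurable_fun setT psi.
Proof.
by apply: measurable_funD; apply: measurable_funM => //; exact: measurable_funX.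
Qed.

Let mcos : measurable_fun setT (fun t => cos (psi t)).
Proof.
apply: measurableT_comp; last exact: mpsi.
by apply: continuous_measurable_fun; exact: continuous_cos.
Qed.

Let msin : measurable_fun setT (fun t => sin (psi t)).
Proof.
apply: measurableT_comp; last exact: mpsi.
by apply: continuous_measurable_fun; exact: continuous_sin.
Qed.

Lemma integ_chirp_re : integ chirp_re.
Proof.
by apply: integB; apply: (@integ_bounded _ 1) => // t;
  [exact: cos_max|exact: sin_max].
Qed.

Lemma integ_chirp_im : integ chirp_im.
Proof.
by apply: integD; apply: (@integ_bounded _ 1) => // t;
  [exact: sin_max|exact: cos_max].
Qed.

Lemma cabs_OLCT_sqr c xi : b != 0 ->
  cabs (OLCT a b c d tau eta h xi) ^+ 2 = `|b^-1| / (2 * pi) *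
    (trig_transform b^-1 chirp_re chirp_im xi ^+ 2 +
     trig_transform b^-1 chirp_im (\- chirp_re) xi ^+ 2).
Proof.
move=> b0.
(* The part of the phase that depends on [xi] alone; it contributes a unimodular factor to [C],
   which the modulus does not see. *)
pose chi := - (b^-1 * xi * (d * tau - b * eta)) + d / (2 * b) * (xi ^+ 2 + tau ^+ 2).
rewrite -(cabs_OLCT_const chi b0).
set C := _ * expj chi.
set U := trig_transform _ _ _ _; set V := trig_transform _ _ (\- _) _.
have iu := integ_chirp_re; have iv := integ_chirp_im; have iNu := integN iu.
pose X t := chirp_re t * cos (b^-1 * xi * t) + chirp_im t * sin (b^-1 * xi * t).
pose Y t := chirp_im t * cos (b^-1 * xi * t) + - chirp_re t * sin (b^-1 * xi * t).
have iX : integ X by exact: (integ_trig _ _ iu iv).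
have iY : integ Y by exact: (integ_trig _ _ iv iNu).
have E t : h t * (sqrtc (Complex 0 (2 * pi * b)))^-1 *
    expj (olct_phase a b d tau eta xi t) =
    Complex (complex.Re C * X t - complex.Im C * Y t)
            (complex.Re C * Y t + complex.Im C * X t).
  have -> : olct_phase a b d tau eta xi t = psi t + chi - b^-1 * xi * t.
    by rewrite /olct_phase /psi /chi; field.
  rewrite /C /X /Y /chirp_re /chirp_im; case: (h t) => x y.
  case: ((sqrtc (Complex 0 (2 * pi * b)))^-1) => k l; rewrite /expj.
  rewrite (cosB (psi t + chi)) (sinB (psi t + chi)) (cosD (psi t)) (sinD (psi t)) /=.
  by apply/eqP; rewrite eq_complex /=; apply/andP; split; apply/eqP; ring.
rewrite /OLCT (_ : (fun t => _) = (fun t =>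
    Complex (complex.Re C * X t - complex.Im C * Y t)
            (complex.Re C * Y t + complex.Im C * X t))); last by apply/funext.
rewrite /cintegral !cabs_sqr; move: (complex.Re C) (complex.Im C) => cr ci /=.
rewrite RintegralB//; try exact: integZ.
rewrite RintegralD//; try exact: integZ.
rewrite !RintegralZl//.
rewrite -[\int[mu]_x X x]/U -[\int[mu]_x Y x]/V; ring.
Qed.

End transform.

End olct.

(** * Moments that may be infinite *)

Section extended_moments.
Context {R : realType}.
Notation mu := (@lebesgue_measure R).
Notation integ f := (mu.-integrable [set: R] (EFin \o f)).

Lemma ge0_integ_or_infty (f : R -> R) : measurable_fun setT f ->
  (forall x, 0 <= f x) -> integ f \/ (\int[mu]_x (f x)%:E = +oo)%E.
Proof.
move=> mf f0; have [fy|fy] := eqVneq (\int[mu]_x (f x)%:E)%E +oo%E; first by right.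
left; apply/integrableP; split; first exact/measurable_EFinP.
under eq_integral do rewrite /= ger0_norm//.
by rewrite ltey.
Qed.

(** The weight vanishes only at [x0], which is a null set, so a zero moment forces [rho] to vanish
    almost everywhere. *)
Lemma moment_eq0 (rho : R -> R) (p x0 : R) : p != 0 -> integ rho ->
  (forall x, 0 <= rho x) ->
  (\int[mu]_x (`|x - x0| `^ p * rho x)%:E = 0)%E -> \int[mu]_x rho x = 0.
Proof.
move=> p0 irho rho0 m0.
have mrho := integ_measurable irho.
have mF : measurable_fun [set: measurableTypeR R]
    (fun x => (`|x - x0| `^ p * rho x)%:E).
  apply/measurable_EFinP; apply: measurable_funM => //.
  have m1 : measurable_fun setT (fun x : R => `|x - x0|).
    by apply: measurableT_comp => //; exact: measurable_funB.
  exact: (measurableT_comp (measurable_powR p) m1).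
have := (ae_eq_integral_abs mu measurableT mF).1.
under eq_integral do rewrite gee0_abs ?lee_fin ?mulr_ge0 ?powR_ge0//.
move=> /(_ m0) F0.
have ae0 : {ae mu, forall x, rho x = 0}.
  have x0ae : {ae mu, forall x, x != x0}.
    exists [set x0]; split => //; first exact: lebesgue_measure_set1.
    by move=> x /= /negP; rewrite negbK => /eqP.
  apply: (@filterS2 _ _ (ae_filter_ringOfSetsType mu)) F0 x0ae => x /(_ I) [] /eqP.
  rewrite mulf_eq0 powR_eq0 normr_eq0 subr_eq0 => /orP[/andP[-> _]//|/eqP //].
have [_ ->] := @integ_ae_eq _ rho (cst 0) (measurable_cst _) irho ae0.
by rewrite Rintegral_cst//= mul0r.
Qed.

End extended_moments.

Theorem theorem3 (R : realType) (a b c d tau eta p tm xim : R)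
    (f : R -> R[i])
    (hdet : a * d - b * c = 1) (hb : b != 0) (hp : 2 <= p)
    (hf : in_L1_cap_L2 f)
    (hO : in_L1_cap_L2 (OLCT a b c d tau eta f))
    (hpO : in_L1_cap_L2
      (fun xi => Complex (`|xi - xim| `^ p) 0 * OLCT a b c d tau eta f xi)) :
  (moment p tm f `^ p^-1%R * moment p xim (OLCT a b c d tau eta f) `^ p^-1%R
   >= (`|b| / 2)%R%:E * (energy f ^+ 2) `^ p^-1%R)%E.
Proof.
have [h [iRe iIm _ fh]] := in_Lspace1 hf.1.
(* The transform is an integral, so passing to the Borel representative [h] leaves it unchanged at
   every [xi]. *)
have OE : OLCT a b c d tau eta f = OLCT a b c d tau eta h.
  apply/funext => xi; apply: eq_cintegral_ae.
  by apply: (@filterS _ _ (ae_filter_ringOfSetsType _)) fh => x ->.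
rewrite OE in hO *; set O := OLCT a b c d tau eta h in hO *.
have [H [_ _ iH OH]] := in_Lspace1 hO.1.
pose u := chirp_re a b tau h; pose v := chirp_im a b tau h.
have iu : lebesgue_measure.-integrable setT (EFin \o u) by exact: integ_chirp_re.
have iv : lebesgue_measure.-integrable setT (EFin \o v) by exact: integ_chirp_im.
pose U := trig_transform b^-1 u v; pose V := trig_transform b^-1 v (\- u).
have b0 : b^-1 != 0 by rewrite invr_neq0.
have pi0 : 0 < pi :> R by exact: pi_gt0.
pose k := `|b^-1| / (2 * pi).
have k0 : 0 < k by rewrite divr_gt0 ?mulr_gt0// normr_gt0.
have absO xi : cabs (O xi) ^+ 2 = k * (U xi ^+ 2 + V xi ^+ 2).
  exact: cabs_OLCT_sqr.
have mU : measurable_fun setT U by exact: measurable_trig_transform.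
have mV : measurable_fun setT V.
  by apply: measurable_trig_transform => //; exact: integN.
have absO' xi : cabs (O xi) = Num.sqrt (k * (U xi ^+ 2 + V xi ^+ 2)).
  by rewrite -absO sqrtr_sqr ger0_norm// cabs_ge0.
(* [|O|] is given at every point by [U] and [V], hence is measurable itself; it inherits
   integrability from the representative [H], and passes it on to [U] and [V], which [|O|] dominates
   up to the factor [1 / sqrt k]. *)
have mO : measurable_fun setT (fun xi => cabs (O xi)).
  under eq_fun do rewrite absO'.
  apply: measurableT_comp; first by apply: continuous_measurable_fun; exact: sqrt_continuous.
  by apply: measurable_funM => //; apply: measurable_funD; exact: measurable_funX.
have iO : lebesgue_measure.-integrable setT (EFin \o (fun xi => cabs (O xi))).
  apply: (integ_ae_eq mO iH _).1.
  by apply: (@filterS _ _ (ae_filter_ringOfSetsType _)) OH => x ->.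
have sk0 : 0 < Num.sqrt k by rewrite sqrtr_gt0.
have le_O (x y xi : R) : x ^+ 2 <= y -> cabs (O xi) = Num.sqrt (k * y) ->
    `|x| <= (Num.sqrt k)^-1 * cabs (O xi).
  move=> xy ->; rewrite (sqrtrM _ (ltW k0)) mulKf ?gt_eqF//.
  by rewrite -sqrtr_sqr ler_wsqrtr.
have iU : lebesgue_measure.-integrable setT (EFin \o U).
  apply: (integ_le mU (integZ (Num.sqrt k)^-1 iO)) => xi.
  by apply: le_O (absO' xi); rewrite lerDl sqr_ge0.
have iV : lebesgue_measure.-integrable setT (EFin \o V).
  apply: (integ_le mV (integZ (Num.sqrt k)^-1 iO)) => xi.
  by apply: le_O (absO' xi); rewrite lerDr sqr_ge0.
have [irho ePl] := trig_Plancherel b0 iu iv iU iV.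
pose rho t := u t ^+ 2 + v t ^+ 2.
pose sigma w := k * (U w ^+ 2 + V w ^+ 2).
have rho0 t : 0 <= rho t by rewrite addr_ge0 ?sqr_ge0.
have sigma0 w : 0 <= sigma w.
  by apply: mulr_ge0; [exact: ltW|rewrite addr_ge0 ?sqr_ge0].
have isigma : lebesgue_measure.-integrable setT (EFin \o sigma).
  by apply: integZ; exact: integ_trig_transform_sqr.
pose E := \int[lebesgue_measure]_t rho t.
have Esigma : \int[lebesgue_measure]_w sigma w = E.
  rewrite RintegralZl//; last exact: integ_trig_transform_sqr.
  rewrite ePl /E /k; move: pi0; move: (@pi R) => P P0; field.
  by rewrite normr_eq0 b0 gt_eqF.
have p0 : 0 < p by exact: lt_le_trans hp.
have energyE : energy f = E%:E.
  rewrite /energy /E EFin_Rint//; apply: ae_eq_integral_nonmeasurable.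
  apply: (@filterS _ _ (ae_filter_ringOfSetsType _)) fh => x ->.
  by rewrite -(chirp_sqr a b tau).
have momf : moment p tm f = (\int[lebesgue_measure]_t (`|t - tm| `^ p * rho t)%:E)%E.
  apply: ae_eq_integral_nonmeasurable.
  apply: (@filterS _ _ (ae_filter_ringOfSetsType _)) fh => x ->.
  by rewrite -(chirp_sqr a b tau).
have momO : moment p xim O = (\int[lebesgue_measure]_w (`|w - xim| `^ p * sigma w)%:E)%E.
  by apply: eq_integral => w _; rewrite absO.
have E0 : 0 <= E by exact: Rintegral_ge0.
rewrite energyE -EFin_expe poweR_EFin -EFinM.
have mom_ge0 (r : R -> R) (x0 : R) : (forall x, 0 <= r x) ->
    (0 <= \int[lebesgue_measure]_x (`|x - x0| `^ p * r x)%:E)%E.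
  by move=> r0; apply: integral_ge0 => x _; rewrite lee_fin mulr_ge0// powR_ge0.
move: E0; rewrite le_eqVlt => /orP[/eqP E0|E0].
  rewrite -E0 expr0n/= powR0 ?invr_neq0 ?gt_eqF// mulr0.
  by rewrite mule_ge0// poweR_ge0.
have mpow (r : R -> R) (x0 : R) : measurable_fun setT r ->
    measurable_fun setT (fun x : R => `|x - x0| `^ p * r x).
  move=> mr; apply: measurable_funM => //.
  have m1 : measurable_fun setT (fun x : R => `|x - x0|).
    by apply: measurableT_comp => //; exact: measurable_funB.
  exact: (measurableT_comp (measurable_powR p) m1).
have pow_ge0 (r : R -> R) (x0 : R) : (forall x, 0 <= r x) ->
    forall x, 0 <= `|x - x0| `^ p * r x.
  by move=> r0 x; rewrite mulr_ge0// powR_ge0.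
(* Once both factors are known to be positive, a single infinite moment makes the product [+oo], and
   only two finite moments remain to be treated. *)
have mom_gt0 (r : R -> R) (x0 : R) :
    lebesgue_measure.-integrable setT (EFin \o r) -> (forall x, 0 <= r x) ->
    \int[lebesgue_measure]_x r x = E ->
    (0 < (\int[lebesgue_measure]_x (`|x - x0| `^ p * r x)%:E) `^ p^-1%R)%E.
  move=> ir r0 rE; apply: poweR_gt0; rewrite lt0e mom_ge0// andbT.
  apply/eqP => /(moment_eq0 (lt0r_neq0 p0) ir r0).
  by rewrite rE => E0'; rewrite E0' ltxx in E0.
have mom_f0 := mom_gt0 rho tm irho rho0 erefl.
have mom_O0 := mom_gt0 sigma xim isigma sigma0 Esigma.
have pV : p^-1 != 0 by rewrite invr_neq0// gt_eqF.
rewrite momf momO.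
have [imf|mfy] := ge0_integ_or_infty (mpow _ tm (integ_measurable irho))
  (pow_ge0 _ tm rho0); last first.
  by rewrite mfy poweRyr// gt0_mulye// leey.
have [imO|mOy] := ge0_integ_or_infty (mpow _ xim (integ_measurable isigma))
  (pow_ge0 _ xim sigma0); last first.
  by rewrite mOy poweRyr// gt0_muley// leey.
have mp := moment_product b0 hp iu iv iU iV imf imO.
rewrite -!EFin_Rint// !poweR_EFin -EFinM lee_fin.
have r1 : 0 <= \int[lebesgue_measure]_t (`|t - tm| `^ p * rho t).
  by apply: Rintegral_ge0 => t _; exact: pow_ge0.
have r2 : 0 <= \int[lebesgue_measure]_w (`|w - xim| `^ p * sigma w).
  by apply: Rintegral_ge0 => t _; exact: pow_ge0.
rewrite -powRM//.
have b2 : (2 * `|b^-1|)^-1 = `|b| / 2 by rewrite normfV invfM invrK mulrC.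
rewrite b2 in mp.
have e1 : `|b| / 2 * (E ^+ 2) `^ p^-1 = (E ^+ 2 * (`|b| / 2) `^ p) `^ p^-1.
  rewrite [RHS]powRM ?sqr_ge0 ?powR_ge0// -[X in _ = _ * X]powRrM divff ?gt_eqF//.
  by rewrite powRr1 1?mulrC// divr_ge0.
rewrite e1; apply: ge0_ler_powR => //.
- by rewrite invr_ge0 ltW.
- by rewrite nnegrE mulr_ge0 ?sqr_ge0 ?powR_ge0.
- by rewrite nnegrE mulr_ge0.
Qed.
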